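(* Let $B$ be a Brownian motion on a filtered complete probability space $(\Omega,\mathcal{G},P,\mathbb{G})$ satisfying the usual conditions, and let $\Lambda\subset\mathbb{R}_+$. For $\beta\in\Lambda$ let $T_\beta=\inf\{t>0:B_t\ge\beta\}$ be the first passage time of $B$ for the level $\beta$. Let $\mathbb{F}=(\mathcal{F}_t)_{t\ge0}$ be given by $$\mathcal{F}^0_t=\sigma(\{T_x\le s\}:s\le t,\ x\in\Lambda),\qquad \mathcal{F}_t=\Big(\bigcap_{u>t}\mathcal{F}^0_u\Big)\vee\mathcal{N},$$ where $\mathcal{N}$ denotes the $P$-null sets of $\mathcal{G}$. Then for a left isolated point $\beta\in\Lambda$ the compensator of $T_\beta$ is absolutely continuous; that is, there exists an $\mathbb{F}$-adapted process $\lambda^\beta=(\lambda^\beta_s)_{s\ge0}$ such that $$1_{\{t\ge T_\beta\}}-\int_0^t\lambda^\beta_s\,ds$$ is an $\mathbb{F}$ martingale.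
   Context: A point $\beta\in\Lambda$ is left isolated (isolated from below in $\Lambda$) if $\sup\{\alpha\in\Lambda:\alpha<\beta\}<\beta$, with the convention $\sup\emptyset=0$. The compensator of a stopping time $T$ is the compensator of the process $1_{\{t\ge T\}}$, here with respect to $\mathbb{F}$. *)

(* Defs.v *)
From HB Require Import structures.
From mathcomp Require Export all_boot all_order all_algebra.
From mathcomp Require Export all_classical all_reals all_analysis.
Export numFieldNormedType.Exports.

Set Implicit Arguments.
Unset Strict Implicit.
Unset Printing Implicit Defensive.

Import Order.TTheory GRing.Theory Num.Theory.

Local Open Scope classical_set_scope.
Local Open Scope ring_scope.

(* The time set [0, +oo[ is encoded by quantifying over t : R with 0 <= t; the
   values at negative times of processes and filtrations are irrelevant. A
   sub-sigma-algebra is represented by the collection of its members. *)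

(* By convention [sup set0 = 0], see [sup0]. *)
Definition left_isolated (R : realType) (L : set R) (b : R) : Prop :=
  L b /\ sup [set a | L a /\ a < b] < b.

Section Filtered.
Context {R : realType} {d : measure_display} {T : measurableType d}.
Variable P : probability T R.
Implicit Types (F : R -> set (set T)) (X : R -> T -> R).

Definition measurable_wrt (H : set (set T)) (f : T -> R) : Prop :=
  forall U : set R, measurable U -> H (f @^-1` U).

Definition null_sets : set (set T) :=
  [set N | measurable N /\ P N = 0%E].

Definition filtration F : Prop :=
  (forall t, 0 <= t -> sigma_algebra setT (F t)) /\
  (forall t, 0 <= t -> F t `<=` measurable) /\
  (forall s t, 0 <= s -> s <= t -> F s `<=` F t).

Definition usual_conditions F : Prop :=
  (forall t, 0 <= t -> F t = \bigcap_(u in [set u | t < u]) F u) /\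
  null_sets `<=` F 0.

Definition adapted F X : Prop :=
  forall t, 0 <= t -> measurable_wrt (F t) (X t).

(* Y is a version of the conditional expectation of X given H. *)
Definition is_condexp (H : set (set T)) (X Y : T -> R) : Prop :=
  measurable_wrt H Y /\ P.-integrable setT (EFin \o Y) /\
  forall A, H A ->
    (\int[P]_(w in A) (Y w)%:E = \int[P]_(w in A) (X w)%:E)%E.

Definition martingale F X : Prop :=
  adapted F X /\
  (forall t, 0 <= t -> P.-integrable setT (EFin \o X t)) /\
  (forall s t, 0 <= s -> s <= t -> is_condexp (F s) (X t) (X s)).

Definition brownian_motion F X : Prop :=
  adapted F X /\
  {ae P, forall w, X 0 w = 0} /\
  {ae P, forall w, {within `[0, +oo[, continuous (fun t => X t w)}} /\
  (forall s t, 0 <= s -> s < t ->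
    forall U : set R, measurable U ->
      (* standard deviation, not variance *)
      P ((fun w => X t w - X s w) @^-1` U) = normal_prob 0 (Num.sqrt (t - s)) U) /\
  (forall s t, 0 <= s -> s < t ->
    forall (A : set T) (U : set R), F s A -> measurable U ->
      P (A `&` (fun w => X t w - X s w) @^-1` U) =
      (P A * P ((fun w => (X t w - X s w)%R) @^-1` U))%E).

(* Equal to +oo when the level is never reached. *)
Definition first_passage X (b : R) (w : T) : \bar R :=
  ereal_inf [set t%:E | t in [set t : R | 0 < t /\ b <= X t w]].

Definition passage_filtration0 X (L : set R) (t : R) : set (set T) :=
  <<s [set A | exists x s, [/\ L x, 0 <= s, s <= t &
                 A = [set w | (first_passage X x w <= s%:E)%E] ] ] >>.

Definition passage_filtration X (L : set R) (t : R) : set (set T) :=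
  <<s (\bigcap_(u in [set u | t < u]) passage_filtration0 X L u)
      `|` null_sets >>.

Definition time_space : set (R * T) := [set p | 0 <= p.1].

Definition left_continuous_paths X : Prop :=
  forall w t, 0 < t -> X s w @[s --> t^'-] --> X t w.

Definition predictable_sigma F : set (set (R * T)) :=
  <<s time_space,
    [set C | exists X (U : set R),
       [/\ adapted F X, left_continuous_paths X, measurable U &
           C = time_space `&` [set p | U (X p.1 p.2)]] ] >>.

Definition predictable F X : Prop :=
  forall U : set R, measurable U ->
    predictable_sigma F (time_space `&` [set p | U (X p.1 p.2)]).

Definition is_compensator F (N A : R -> T -> R) : Prop :=
  [/\ predictable F A,
      (forall w, A 0 w = 0),
      (forall w s t, 0 <= s -> s <= t -> A s w <= A t w),
      (forall w t, 0 <= t -> A s w @[s --> t^'+] --> A t w) &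
      martingale F (fun t w => N t w - A t w)].

Definition occurred (tau : T -> \bar R) (t : R) (w : T) : R :=
  \1_[set w | (tau w <= t%:E)%E] w.

(* The conditions on l besides adaptedness make the process of its path
   integrals well defined. *)
Definition absolutely_continuous_compensator F (tau : T -> \bar R) : Prop :=
  exists l : R -> T -> R,
    [/\ adapted F l,
        measurable_fun time_space (fun p : R * T => l p.1 p.2),
        (forall w t, 0 <= t ->
          lebesgue_measure.-integrable `[0, t] (fun s => (l s w)%:E)) &
        is_compensator F (occurred tau)
          (fun t w => \int[lebesgue_measure]_(s in `[0, t]) l s w)].

End Filtered.

(* Main.v *)
Require Import Defs.
From mathcomp Require Import ring lra measurable_realfun.

(** Put [c := b - sup M], where [M] is the set of the levels of [L] below [b]; it is
    positive because [b] is left isolated. Let [S] be the time by which all the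
    levels of [M] have been passed and [Tb] the passage time at [b]. At the time
    [S] the path is at the level [sup M], so it still has to climb the distance
    [c], and by the strong Markov property it does so as a fresh Brownian motion.
    Hence, given the whole past of [S] in the Brownian filtration, [Tb - S] has the
    law of the first passage time at the level [c]. By the reflection principle
    this law has the explicit survival function [passage_survival c] and a
    continuous hazard rate [passage_hazard c], and the intensity is the hazard
    rate at the time elapsed since [S], on the set where [S < s < Tb].

    [markov_test_continuous] proves the strong Markov property by rounding the
    stopping time up to a grid, and [markov_test_limit] extends it to indicators
    of half-lines. It is applied at [S] and at [Tb], in each case at a time when
    the value of the process is known. [reflection] combines the two: at a time
    [v] the paths below [b] that have already passed [b] are as likely as the paths
    above [b]. The result is [passage_law], the conditional law of [Tb] given the
    past of [S].

    Integrating the hazard rate against this conditional law, with two exchanges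
    of integrals, gives [compensation]: on each event of the past of [S], the
    probability of a passage before [t] is the expectation of the integrated
    intensity up to [t]. Since the integrated hazard rate is minus the logarithm
    of the survival function, the integral is a continuous function of the stopping
    times capped at [t], hence adapted and predictable.

    It remains to descend from the past of [S] to the observed filtration. This is
    [trace_before_passage]: on the event that [b] has not been passed at the time
    [u], each event observed before [u] coincides with an event of the past of [S],
    because the levels above [b] cannot have been passed. Once [b] is passed
    nothing moves any more, so the increments of the compensated process have
    integral 0 over the observed events. *)

Set Implicit Arguments.
Unset Strict Implicit.
Unset Printing Implicit Defensive.

Import Order.TTheory GRing.Theory Num.Theory.

Local Open Scope classical_set_scope.
Local Open Scope ring_scope.

(** * Gaussian mass of segments *)

Section Gaussian.
Context {R : realType}.
Implicit Types c r s x y : R.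
Notation mu := (@lebesgue_measure R).

Lemma normal_prob_half_lines s : s != 0 ->
  normal_prob 0 s `]-oo, 0%R[ = normal_prob 0 s `]0%R, +oo[.
Proof.
move=> s0; rewrite /normal_prob.
have mpdf (D : set R) : measurable_fun D (EFin \o normal_pdf 0 s).
  by apply/measurable_EFinP; apply: measurable_funTS; exact: measurable_normal_pdf.
rewrite integral_itv_bndo_bndc// integral_itv_obnd_cbnd// -[X in `]-oo, X]]oppr0.
rewrite ge0_integration_by_substitutionNy//.
- apply: eq_integral => x _ /=; rewrite !normal_pdfE// /normal_fun.
  by rewrite !subr0 sqrrN.
- apply: continuous_subspaceT => x; exact: continuous_normal_pdf.
- by move=> x _; exact: normal_pdf_ge0.
Qed.

Lemma normal_pdf_scale s x : 0 < s ->
  normal_pdf 0 s (s * x) * s = normal_pdf 0 1 x.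
Proof.
move=> s0; rewrite !normal_pdfE ?oner_eq0 ?gt_eqF// /normal_fun /normal_peak !subr0.
have -> : - (s * x) ^+ 2 / (s ^+ 2 *+ 2) = - x ^+ 2 / (1 ^+ 2 *+ 2).
  by field; rewrite gt_eqF.
rewrite expr1n mul1r -mulrnAr sqrtrM ?sqr_ge0// sqrtr_sqr gtr0_norm// invfM.
by rewrite mulrC !mulrA divff ?gt_eqF// mul1r.
Qed.

Lemma continuous_within (f : R -> R) (A : set R) : continuous f ->
  {within A, continuous f}.
Proof. by move=> cf; apply: continuous_subspaceT => x; exact: cf. Qed.

Definition gauss_mass y : R := \int[mu]_(x in `[0, y]) normal_pdf 0 1 x.

Lemma integrable_normal_pdf_segment s a b : s != 0 ->
  mu.-integrable `[a, b] (fun x => (normal_pdf 0 s x)%:E).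
Proof.
move=> s0; apply: (integrableS (measurableT)) => //; exact: integrable_normal_pdf.
Qed.

(** Scaling reduces every centred Gaussian law to the standard one, so that the
    standard deviation only enters through the end point of the segment. *)
Lemma normal_prob_segment s c : 0 < s -> 0 <= c ->
  normal_prob 0 s `[0, c] = (gauss_mass (c / s))%:E.
Proof.
move=> s0 c0.
have sn0 : s != 0 by rewrite gt_eqF.
have F0 : 0 = s * 0 by rewrite mulr0.
have Fc : c = s * (c / s) by rewrite mulrCA divff ?mulr1.
have F'E : derive1 (fun y : R => s * y) = cst s.
  by apply/funext => x; rewrite derive1E deriveZ// derive_id scaler1.
rewrite /normal_prob {1}F0 {1}Fc.
rewrite (@integration_by_substitution_increasing _ (fun y => s * y)) ?F'E//; last first.
- exact/continuous_within/continuous_normal_pdf.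
- split => [x _||].
  + by apply: derivableM.
  + by apply: cvg_at_right_filter; apply: cvgMr; exact: cvg_id.
  + by apply: cvg_at_left_filter; apply: cvgMr; exact: cvg_id.
- exact: is_cvg_cst.
- exact: is_cvg_cst.
- by move=> x _; exact: cvg_cst.
- by move=> x y _ _ xy; rewrite ltr_pM2l.
- by rewrite divr_ge0// ltW.
rewrite /gauss_mass /Rintegral fineK.
  by apply: eq_integral => x _ /=; rewrite fctE /= normal_pdf_scale.
by apply: integrable_fin_num => //; apply: integrable_normal_pdf_segment; exact: oner_neq0.
Qed.

Lemma gauss_massE y : (gauss_mass y)%:E = normal_prob 0 1 `[0, y].
Proof.
rewrite /gauss_mass /Rintegral fineK//.
by apply: integrable_fin_num => //; apply: integrable_normal_pdf_segment; exact: oner_neq0.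
Qed.

Lemma gauss_mass_gt0 y : 0 < y -> 0 < gauss_mass y.
Proof.
move=> y0; rewrite -lte_fin gauss_massE.
have n10 : (1 : R) != 0 by exact: oner_neq0.
apply: (@lt_le_trans _ _ (\int[mu]_(x in `[0%R, y]) (normal_pdf 0 1 y)%:E)%E).
  rewrite integral_cst//= lebesgue_measure_itv/= lte_fin y0 oppr0 adde0 -EFinM lte_fin.
  by rewrite mulr_gt0// normal_pdfE// mulr_gt0 ?expR_gt0// normal_peak_gt0.
apply: ge0_le_integral => //=.
- by move=> x _; rewrite lee_fin normal_pdf_ge0.
- apply/measurable_EFinP; apply: measurable_funTS; exact: measurable_normal_pdf.
- move=> x; rewrite in_itv/= => /andP[x0 xy]; rewrite lee_fin !normal_pdfE//.
  rewrite ler_wpM2l ?normal_peak_ge0// ler_expR !subr0 ler_pM2r; last first.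
    by rewrite invr_gt0 expr1n.
  by rewrite lerN2 lerXn2r// nnegrE// ltW.
Qed.

Lemma is_derive_gauss_mass y : 0 < y -> is_derive y 1 gauss_mass (normal_pdf 0 1 y).
Proof.
move=> y0; have n10 : (1 : R) != 0 by exact: oner_neq0.
have y1 : y < y + 1 by rewrite ltrDl.
have [d1 d2] := continuous_FTC1_closed y1 (integrable_normal_pdf_segment 0 (y + 1) n10) y0
  (@continuous_normal_pdf _ 0 1 n10 y).
by apply: DeriveDef; [exact: d1|rewrite -derive1E d2].
Qed.

Lemma gauss_mass_nondecreasing : {homo gauss_mass : x y / x <= y}.
Proof.
move=> x y xy; rewrite -lee_fin !gauss_massE; apply: le_measure => //=.
- by rewrite inE.
- by rewrite inE.
- by move=> z /=; rewrite !in_itv/= => /andP[-> /le_trans->].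
Qed.

Lemma normal_prob_positive_half s : s != 0 ->
  normal_prob 0 s `[0%R, +oo[ = (2^-1)%:E.
Proof.
move=> s0.
have mpdf (D : set R) : measurable_fun D (EFin \o normal_pdf 0 s).
  by apply/measurable_EFinP; apply: measurable_funTS; exact: measurable_normal_pdf.
have h : normal_prob 0 s `]-oo, 0%R[ = normal_prob 0 s `[0%R, +oo[.
  by rewrite normal_prob_half_lines// /normal_prob integral_itv_obnd_cbnd.
have e : (normal_prob 0 s `[0%R, +oo[ + normal_prob 0 s `]-oo, 0%R[ = 1)%E.
  rewrite -(probability_setT (normal_prob 0 s)) -(setUv `[0%R, +oo[) measureU//.
  - by rewrite setCitvr.
  - exact: measurableC.
  - by rewrite setICr.
move: e; rewrite h.
have /fineK <- : normal_prob 0 s `[0%R, +oo[ \is a fin_num by exact: fin_num_measure.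
move=> [e]; congr (_%:E); lra.
Qed.

Lemma gauss_mass_le_half y : gauss_mass y <= 2^-1.
Proof.
have n10 : (1 : R) != 0 by exact: oner_neq0.
rewrite -lee_fin gauss_massE -(normal_prob_positive_half n10).
apply: le_measure; rewrite ?inE// => z /=; rewrite !in_itv/= andbT.
by move=> /andP[].
Qed.

Lemma gauss_mass_cvg : gauss_mass y @[y --> +oo] --> (2^-1 : R).
Proof.
have n10 : (1 : R) != 0 by exact: oner_neq0.
(* along the integers this is continuity from below of the law *)
have cvgn : gauss_mass n%:R @[n --> \oo] --> (2^-1 : R).
  suff /fine_cvgP[] : (gauss_mass n%:R)%:E @[n --> \oo] --> (2^-1 : R)%:E by [].
  rewrite -(normal_prob_positive_half n10).
  have -> : `[0%R, +oo[%classic = \bigcup_n `[0%R, n%:R : R]%classic.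
    apply/seteqP; split => [x /=|x [n _] /=]; rewrite !in_itv/= ?andbT.
      move=> x0; exists (Num.bound x) => //=; rewrite in_itv/= x0 ltW//.
      by rewrite (le_lt_trans (ler_norm _))// ger0_norm// archi_boundP.
    by case/andP.
  rewrite (_ : (fun n => _) = normal_prob 0 1 \o (fun n => `[0%R, n%:R : R]%classic)).
    apply: nondecreasing_cvg_mu => //.
      exact: bigcup_measurable.
    move=> n m nm; apply/subsetPset => x /=; rewrite !in_itv/= => /andP[-> /le_trans->]//.
    by rewrite ler_nat.
  by apply/funext => n /=; rewrite gauss_massE.
apply/cvgrPdist_le => e e0.
move/cvgrPdist_le : cvgn => /(_ _ e0) [N _ /(_ N (leqnn _))] /= hN.
near=> y.
have yN : N%:R <= y by near: y; exact: nbhs_pinfty_ge.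
rewrite (le_trans _ hN)// !ger0_norm ?subr_ge0 ?gauss_mass_le_half//.
by rewrite lerD2l lerN2 gauss_mass_nondecreasing.
Unshelve. all: by end_near. Qed.

End Gaussian.

(** * Survival function and hazard rate of a passage time *)

Section Passage.
Context {R : realType}.
Variable c : R.
Hypothesis c0 : 0 < c.
Implicit Types r s x y : R.
Notation mu := (@lebesgue_measure R).

(** The probability that a Brownian motion stays below the level [c] up to the
    time [r], as computed by the reflection principle: it is the Gaussian mass,
    for the variance [r], of the segment of half-length [c] around 0. *)
Definition passage_survival r : R :=
  if r <= 0 then 1 else 2 * gauss_mass (c / Num.sqrt r).

(** The opposite of the derivative of the survival function, that is, the density
    of the first passage time at the level [c]. *)
Definition passage_density r : R :=
  if r <= 0 then 0
  else c / (r * Num.sqrt r) * normal_pdf 0 1 (c / Num.sqrt r).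

Definition passage_hazard r : R := passage_density r / passage_survival r.

Lemma passage_survival_gt0 r : 0 < passage_survival r.
Proof.
rewrite /passage_survival; case: (leP r 0) => //= r0.
by rewrite mulr_gt0// gauss_mass_gt0// divr_gt0// sqrtr_gt0.
Qed.

Lemma passage_survival_le1 r : passage_survival r <= 1.
Proof.
rewrite /passage_survival; case: (leP r 0) => //= r0.
have := gauss_mass_le_half (c / Num.sqrt r); lra.
Qed.

Lemma passage_density_ge0 r : 0 <= passage_density r.
Proof.
rewrite /passage_density; case: (leP r 0) => //= r0.
by rewrite mulr_ge0 ?normal_pdf_ge0// divr_ge0 ?ltW// mulr_gt0// sqrtr_gt0.
Qed.

Lemma passage_hazard_ge0 r : 0 <= passage_hazard r.
Proof. by rewrite divr_ge0 ?passage_density_ge0// ltW// passage_survival_gt0. Qed.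

Lemma passage_hazardK r : passage_hazard r * passage_survival r = passage_density r.
Proof. by rewrite divfK// gt_eqF// passage_survival_gt0. Qed.

Lemma passage_density0 r : r <= 0 -> passage_density r = 0.
Proof. by rewrite /passage_density => ->. Qed.

Lemma passage_hazard0 r : r <= 0 -> passage_hazard r = 0.
Proof. by rewrite /passage_hazard => /passage_density0->; rewrite mul0r. Qed.

Lemma passage_survival0 : passage_survival 0 = 1.
Proof. by rewrite /passage_survival lexx. Qed.

(** The form in which the reflection principle produces the survival function:
    the mass below [c] minus the mass above [c]. By symmetry about 0 the
    difference is twice the mass of the segment from 0 to [c]. *)
Lemma normal_prob_survival r : 0 < r ->
  normal_prob 0 (Num.sqrt r) `]-oo, c[ =
  (normal_prob 0 (Num.sqrt r) `]c, +oo[ + (passage_survival r)%:E)%E.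
Proof.
move=> r0; have s0 : 0 < Num.sqrt r by rewrite sqrtr_gt0.
set s := Num.sqrt r in s0 *; have sn0 : s != 0 by rewrite gt_eqF.
have mpdf (D : set R) : measurable_fun D (EFin \o normal_pdf 0 s).
  by apply/measurable_EFinP; apply: measurable_funTS; exact: measurable_normal_pdf.
have hc := normal_prob_segment s0 (ltW c0).
have splitl : (normal_prob 0 s `]-oo, c[ =
    normal_prob 0 s `]-oo, 0%R[ + normal_prob 0 s `[0%R, c])%E.
  rewrite /normal_prob integral_itv_bndo_bndc//.
  rewrite (@itv_bndbnd_setU _ _ -oo%O (BLeft 0) (BRight c)) ?bnd_simp ?ltW//.
  rewrite ge0_integral_setU//; [exact: mpdf| |].
    by move=> y _; rewrite lee_fin normal_pdf_ge0.
  by apply/disj_setPS => x [] /=; rewrite !in_itv/=; lra.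
have splitr : (normal_prob 0 s `[0%R, +oo[ =
    normal_prob 0 s `[0%R, c] + normal_prob 0 s `]c, +oo[)%E.
  rewrite /normal_prob.
  rewrite (@itv_bndbnd_setU _ _ (BLeft 0) (BRight c) +oo%O) ?bnd_simp ?ltW//.
  rewrite ge0_integral_setU//; [exact: mpdf| |].
    by move=> y _; rewrite lee_fin normal_pdf_ge0.
  by apply/disj_setPS => x [] /=; rewrite !in_itv/=; lra.
have hhalf : normal_prob 0 s `]-oo, 0%R[ = normal_prob 0 s `[0%R, +oo[.
  by rewrite normal_prob_half_lines// /normal_prob integral_itv_obnd_cbnd.
rewrite splitl hhalf splitr hc -addeA addeC -addeA; congr (_ + _)%E.
by rewrite -EFinD /passage_survival leNgt r0/= mulr2n mulrDl !mul1r.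
Qed.

Lemma is_derive_passage_survival r : 0 < r ->
  is_derive r 1 passage_survival (- passage_density r).
Proof.
move=> r0; have s0 : 0 < Num.sqrt r by rewrite sqrtr_gt0.
apply: (@near_eq_is_derive _ _ _ (fun r => 2 * gauss_mass (c / Num.sqrt r))).
- by near=> x; rewrite /passage_survival leNgt (_ : 0 < x)//; near: x; exact: lt_nbhsr.
have d1 := is_derive1_sqrt r0.
have d2 := is_deriveV (lt0r_neq0 s0) d1.
have d3 := is_derive_gauss_mass (divr_gt0 c0 s0).
have d4 := @is_derive1_comp _ _ (fun r => c * (Num.sqrt r)^-1) r _ _ d3 (is_deriveZ c d2).
apply: (is_derive_eq (is_deriveZ 2 d4)).
rewrite /passage_density leNgt r0/= /GRing.scale /=.
have -> : r * Num.sqrt r = Num.sqrt r ^+ 3 by rewrite exprSr sqr_sqrtr// ltW.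
by field; rewrite gt_eqF.
Unshelve. all: by end_near. Qed.

(** Near 0 the Gaussian factor beats the power of [r], because exp(-y) <= 4/y^2;
    hence the density and the hazard rate extend continuously by 0 to the
    negative times. *)
Lemma passage_density_le r : 0 < r ->
  passage_density r <= 16 * normal_peak 1 / c ^+ 3 * Num.sqrt r.
Proof.
move=> r0; have s0 : 0 < Num.sqrt r by rewrite sqrtr_gt0.
rewrite /passage_density (lt_geF r0) normal_pdfE ?oner_neq0// /normal_fun subr0.
set y := (c / Num.sqrt r) ^+ 2 / 2.
have -> : - (c / Num.sqrt r) ^+ 2 / (1 ^+ 2 *+ 2) = - y by rewrite expr1n mulNr.
have y0 : 0 < y by rewrite divr_gt0// exprn_gt0// divr_gt0.
have ey : expR (- y) <= 4 / y ^+ 2.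
  rewrite expRN ler_pdivlMr ?exprn_gt0// mulrC ler_pdivrMr ?expR_gt0//.
  have -> : y = y / 2 + y / 2 by field.
  rewrite expRD; have := expR_ge1Dx (y / 2) => h; nra.
have k0 : 0 <= c / (r * Num.sqrt r) * normal_peak 1.
  by rewrite mulr_ge0 ?normal_peak_ge0// divr_ge0 ?ltW// mulr_gt0.
rewrite mulrA (le_trans (ler_wpM2l k0 ey))// le_eqVlt; apply/orP; left; apply/eqP.
have cn0 : c != 0 by rewrite gt_eqF.
have sn0 : Num.sqrt r != 0 by rewrite gt_eqF.
have -> : r * Num.sqrt r = Num.sqrt r ^+ 3 by rewrite exprSr sqr_sqrtr// ltW.
rewrite /y.
by field; rewrite cn0 sn0.
Qed.

Lemma passage_density_cvg0 : passage_density x @[x --> 0^'+] --> (0 : R).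
Proof.
apply: (@squeeze_cvgr _ _ _ _ (cst 0) (fun r => 16 * normal_peak 1 / c ^+ 3 * Num.sqrt r)).
- near=> r; rewrite passage_density_ge0/= passage_density_le//.
- exact: cvg_cst.
- rewrite -[X in _ --> X](mulr0 (16 * normal_peak 1 / c ^+ 3)).
  apply: cvgMr; rewrite -[X in _ --> X](@sqrtr0 R).
  apply: cvg_at_right_filter; exact: sqrt_continuous.
Unshelve. all: by end_near. Qed.

Lemma continuous_extension (f : R -> R) (a : R) :
  (forall x, x <= 0 -> f x = a) -> f x @[x --> 0^'+] --> a ->
  (forall x, 0 < x -> {for x, continuous f}) -> continuous f.
Proof.
move=> f0 fa fc x; have [x0|x0|->] := ltgtP x 0; last 2 first.
- exact: fc.
- apply/left_right_continuousP; split; rewrite f0//.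
  apply: cvg_near_cst.
  by near=> y; apply: f0; exact: ltW.
apply: cvg_near_cst; near=> y; rewrite f0 ?f0 ?(ltW x0)// ltW//.
by near: y; exact: lt_nbhsl.
Unshelve. all: by end_near. Qed.

Lemma continuous_passage_density : continuous passage_density.
Proof.
apply: (@continuous_extension _ 0); [exact: passage_density0|exact: passage_density_cvg0|].
move=> x x0; have s0 : 0 < Num.sqrt x by rewrite sqrtr_gt0.
pose g r := c / (r * Num.sqrt r) * normal_pdf 0 1 (c / Num.sqrt r).
suff : {for x, continuous g}.
  move=> cg; apply: (@cvg_trans _ (g @ x)).
    apply: near_eq_cvg; near=> y; rewrite /passage_density lt_geF//.
    by near: y; exact: lt_nbhsr.
  by rewrite /passage_density (lt_geF x0).
have cs : Num.sqrt y @[y --> x] --> Num.sqrt x by exact: sqrt_continuous.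
have cc : c / Num.sqrt y @[y --> x] --> c / Num.sqrt x.
  by apply: cvgMr; apply: cvgV => //; rewrite gt_eqF.
apply: cvgM.
  by apply: cvgMr; apply: cvgV; [rewrite gt_eqF// mulr_gt0|exact: cvgM].
apply: (@cvg_comp _ _ _ (fun y => c / Num.sqrt y) (normal_pdf 0 1) _ _ _ cc).
exact/continuous_normal_pdf/oner_neq0.
Unshelve. all: by end_near. Qed.

Lemma continuous_passage_survival : continuous passage_survival.
Proof.
apply: (@continuous_extension _ 1).
- by move=> x x0; rewrite /passage_survival x0.
- have -> : (1 : R) = 2 * 2^-1 by rewrite divff.
  apply: (@cvg_trans _ ((fun r => 2 * gauss_mass (c / Num.sqrt r)) @ 0^'+)).
    by apply: near_eq_cvg; near=> r; rewrite /passage_survival lt_geF.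
  apply: cvgMr; apply: (cvg_comp _ gauss_mass); last exact: gauss_mass_cvg.
  apply/cvgryPge => M; near=> r.
  have s0 : 0 < Num.sqrt r by rewrite sqrtr_gt0.
  have K0 : 0 < `|M| + 1 by rewrite ltr_wpDl.
  rewrite (@le_trans _ _ (`|M| + 1))//; first by rewrite (le_trans (ler_norm _))// lerDl.
  rewrite ler_pdivlMr// mulrC -ler_pdivlMr//.
  rewrite -(ger0_norm (ltW (divr_gt0 c0 K0))) -sqrtr_sqr ler_sqrt ?sqr_ge0//.
  by near: r; apply: nbhs_right_le; rewrite exprn_gt0// divr_gt0.
- move=> x x0; have [dS _] := is_derive_passage_survival x0.
  exact/differentiable_continuous/derivable1_diffP.
Unshelve. all: by end_near. Qed.

Lemma continuous_passage_hazard : continuous passage_hazard.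
Proof.
move=> x; apply: cvgM; first exact: continuous_passage_density.
apply: cvgV; last exact: continuous_passage_survival.
by rewrite gt_eqF// passage_survival_gt0.
Qed.

End Passage.

(** * Integrals along the time elapsed since a random time *)

Section Elapsed.
Context {R : realType}.
Implicit Types (S : \bar R) (s t : R).
Notation mu := (@lebesgue_measure R).

(** The positive part of [s - S], written so that it makes sense when [S] is
    infinite: it is then 0 at all times. *)
Definition elapsed S s : R := s - fine (mine s%:E S).

Lemma elapsed_before S s : (s%:E <= S)%E -> elapsed S s = 0.
Proof. by move=> sS; rewrite /elapsed min_l//= subrr. Qed.

Lemma elapsed_after S s : (0 <= S)%E -> (S <= s%:E)%E -> elapsed S s = s - fine S.
Proof. by move=> S0 Ss; rewrite /elapsed min_r. Qed.

(** The fundamental theorem of calculus for the translate of [K] that starts at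
    [S]. Only positive times enter the derivative of [K], since the integrand
    vanishes before [S]. *)
Lemma integral_elapsed (k K : R -> R) S t : continuous k -> continuous K ->
  (forall r : R, r <= 0 -> k r = 0) ->
  (forall r : R, 0 < r -> is_derive r 1 K (k r)) -> (0 <= S)%E -> 0 <= t ->
  (\int[mu]_(s in `[0%R, t]) (k (elapsed S s))%:E =
   (K (elapsed S t) - K 0)%:E)%E.
Proof.
move=> ck cK k0 dK S0 t0.
have [tS|St] := leP t%:E S.
  rewrite elapsed_before// subrr integral0_eq// => s /=.
  rewrite in_itv/= => /andP[_ st]; rewrite elapsed_before ?k0//.
  by rewrite (le_trans _ tS)// lee_fin.
rewrite (elapsed_after S0 (ltW St)).
move: S S0 St => [r||]//=; rewrite !lee_fin lte_fin => r0 rt.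
have cke : continuous (fun s => k (s - r)).
  move=> x; apply: (@cvg_comp _ _ _ (fun s => s - r) k); last exact: ck.
  by apply: cvgB; [exact: cvg_id|exact: cvg_cst].
have cKe : continuous (fun s => K (s - r)).
  move=> x; apply: (@cvg_comp _ _ _ (fun s => s - r) K); last exact: cK.
  by apply: cvgB; [exact: cvg_id|exact: cvg_cst].
have dKe (x : R) : r < x -> is_derive x 1 (fun s => K (s - r)) (k (x - r)).
  rewrite -subr_gt0 => /dK dKx.
  have dsub : is_derive x 1 (fun s : R => s - r) (1 - 0).
    exact: (is_deriveB (is_derive_id x 1) (is_derive_cst r x 1)).
  by have := @is_derive1_comp _ _ (fun s => s - r) _ _ _ dKx dsub; rewrite subr0 mulr1.
transitivity (\int[mu]_(s in `[r, t]) (k (s - r))%:E)%E; last first.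
  rewrite (@continuous_FTC2 _ _ (fun s => K (s - r)))//; first by rewrite subrr EFinB.
  - exact: continuous_within.
  - split.
    + by move=> x; rewrite in_itv/= => /andP[/dKe[]].
    + exact/cvg_at_right_filter/cKe.
    + exact/cvg_at_left_filter/cKe.
  - by move=> x; rewrite in_itv/= => /andP[/dKe[_ d2] _]; rewrite derive1E d2.
transitivity (\int[mu]_(s in `[0%R, t]) ((fun s => (k (s - r))%:E) \_ `[r, t]) s)%E.
  apply: eq_integral => s; rewrite inE/= in_itv/= => /andP[s0 st].
  rewrite patchE mem_setE in_itv/= st andbT.
  have [rs|sr] := leP r s; first by rewrite elapsed_after.
  by rewrite elapsed_before ?k0// lee_fin ltW.
rewrite -integral_mkcondr (_ : _ `&` _ = `[r, t]%classic)//.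
apply/seteqP; split => s /=; first by case.
rewrite !in_itv/= => /andP[rs st]; rewrite rs st (le_trans r0 rs).
by split.
Qed.

End Elapsed.

(** * Passage times of a continuous path *)

Section Paths.
Context {R : realType}.
Implicit Types (x : R -> R) (a r s t : R) (M : set R).

(** The first passage of a single path; it is convertible to the value of
    [first_passage] on that path. *)
Definition passage_time x a : \bar R :=
  ereal_inf [set t%:E | t in [set t : R | 0 < t /\ a <= x t]].

Lemma le_passage_time x : {homo passage_time x : a b / a <= b >-> (a <= b)%E}.
Proof.
move=> a b ab; apply: ereal_inf_le_tmp => _ [t [t0 bt] <-].
by exists t => //; split=> //; exact: le_trans bt.
Qed.

Lemma passage_time_ge0 x a : (0 <= passage_time x a)%E.
Proof. by apply: le_ereal_inf_tmp => _ [t [t0 _] <-]; rewrite lee_fin ltW. Qed.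

Lemma passage_time_le x a t : 0 < t -> a <= x t -> (passage_time x a <= t%:E)%E.
Proof. by move=> t0 xt; apply: ereal_inf_lbound; exists t. Qed.

Lemma before_passage x a t : 0 < t -> (t%:E < passage_time x a)%E -> x t < a.
Proof. by move=> t0; apply: contraTT; rewrite -!leNgt; exact: passage_time_le. Qed.

Lemma passage_time_lt x a t : (passage_time x a < t%:E)%E ->
  exists s, [/\ 0 < s, s < t & a <= x s].
Proof. by move=> /ereal_inf_lt[_ [s [s0 xs] <-]]; rewrite lte_fin; exists s. Qed.

Definition continuous_path x := x 0 = 0 /\ {within `[0, +oo[, continuous x}.

Lemma continuous_path_near x t e : continuous_path x -> 0 <= t -> 0 < e ->
  exists2 h, 0 < h & forall s, 0 <= s -> `|s - t| < h -> `|x s - x t| < e.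
Proof.
move=> [_ /subspace_continuousP cx] t0 e0.
have /cx : `[0, +oo[%classic t by rewrite /= in_itv/= t0.
move=> /cvgrPdist_lt/(_ _ e0); rewrite near_withinE => -[h /= h0 hh].
exists h => // s s0 st; rewrite distrC; apply: hh => /=; first by rewrite distrC.
by rewrite in_itv/= s0.
Qed.

(** By right continuity the path is at least at the level [a] at the passage time,
    and by left continuity it is at most there. *)
Lemma at_passage_time x a t : continuous_path x -> 0 <= a ->
  passage_time x a = t%:E -> x t = a.
Proof.
move=> px a0 ta; have t0 : 0 <= t by rewrite -lee_fin -ta passage_time_ge0.
have [xa|xa|//] := ltgtP (x t) a; exfalso.
- have /(continuous_path_near px t0)[h h0 xh] : 0 < a - x t by rewrite subr_gt0.
  have /passage_time_lt[s [s0 sth xs]] : (passage_time x a < (t + h)%:E)%E.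
    by rewrite ta lte_fin ltrDl.
  have ts : t <= s by rewrite -lee_fin -ta passage_time_le.
  have := xh s (ltW s0); rewrite !ltr_norml => /(_ _)/wrap[]; lra.
- have tgt0 : 0 < t.
    rewrite lt_neqAle t0 andbT; apply/eqP => t0'.
    by move: xa; rewrite -t0' (proj1 px) ltNge a0.
  have /(continuous_path_near px t0)[h h0 xh] : 0 < x t - a by rewrite subr_gt0.
  pose s := Num.max (t / 2) (t - h / 2).
  have [s1 s2] : t / 2 <= s /\ t - h / 2 <= s by split; rewrite le_max lexx ?orbT.
  have st : s < t by rewrite gt_max; lra.
  have s0 : 0 < s by lra.
  have xs : a <= x s.
    have := xh s (ltW s0); rewrite !ltr_norml => /(_ _)/wrap[]; lra.
  by have := passage_time_le s0 xs; rewrite ta lee_fin leNgt st.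
Qed.

(** Strict inequality is what rational times can detect: a path that comes
    arbitrarily close to the level on a compact time interval reaches it. *)
Lemma passage_time_ltP x a t : continuous_path x ->
  (passage_time x a < t%:E)%E <-> exists m : nat, forall k : nat, exists q : rat,
    [/\ m.+1%:R^-1 <= ratr q :> R, ratr q <= t - m.+1%:R^-1 & a - k.+1%:R^-1 < x (ratr q)].
Proof.
move=> px; split.
- move=> /passage_time_lt[s [s0 st xs]].
  have d0 : 0 < Num.min s (t - s) by rewrite lt_min s0 subr_gt0.
  have [m md] : exists m : nat, m.+1%:R^-1 < Num.min s (t - s).
    by have [m _ /(_ m (leqnn _))] := near_infty_natSinv_lt (PosNum d0); exists m.
  exists m => k; set v := k.+1%:R^-1; have k0 : 0 < v :> R by rewrite invr_gt0.
  have [h h0 xh] := continuous_path_near px (ltW s0) k0.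
  move: md; rewrite lt_min; set u := m.+1%:R^-1 => /andP[md1 md2].
  have u0 : 0 < u by rewrite invr_gt0.
  have ltLU : Num.max u (s - h) < Num.min (t - u) (s + h).
    rewrite lt_min !gt_max. by apply/andP; split; apply/andP; split; lra.
  have [q] := rat_in_itvoo ltLU.
  rewrite in_itv/= lt_min !gt_max => /andP[/andP[q1 q2] /andP[q3 q4]].
  exists q; split; [lra|lra|].
  have q0 : 0 <= ratr q :> R by lra.
  have := xh _ q0; rewrite !ltr_norml => /(_ _)/wrap[]; lra.
- move=> [m]; set u := m.+1%:R^-1 => hm; have u0 : 0 < u by rewrite invr_gt0.
  have [q0 [q01 q02 _]] := hm 0.
  have cx : {within `[u, t - u], continuous x}.
    apply: continuous_subspaceW (proj2 px) => s /=; rewrite !in_itv/= andbT => /andP[+ _].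
    by apply: le_trans; exact: ltW.
  have [s + xmax] := EVT_max (le_trans q01 q02) cx.
  rewrite in_itv/= => /andP[s1 s2].
  have xs : a <= x s.
    apply/ler_addgt0Pr => e e0.
    have [k _ /(_ k (leqnn _)) /= ke] := near_infty_natSinv_lt (PosNum e0).
    have [q [q1 q2 xq]] := hm k.
    have /xmax : ratr q \in `[u, t - u] by rewrite in_itv/= q1.
    by move=> xqs; move: ke xq; set v := k.+1%:R^-1; lra.
  apply: (@le_lt_trans _ _ s%:E); first by apply: passage_time_le => //; lra.
  by rewrite lte_fin; lra.
Qed.

(** The time by which all the levels of [M] have been passed. Including 0 in the
    supremum makes it the starting time when [M] is empty. *)
Definition last_passage_time x M : \bar R :=
  ereal_sup (0%E |` [set passage_time x a | a in M]).

Lemma last_passage_time_ge0 x M : (0 <= last_passage_time x M)%E.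
Proof. by apply: ereal_sup_ubound; left. Qed.

Lemma le_last_passage_time x M a : M a -> (passage_time x a <= last_passage_time x M)%E.
Proof. by move=> Ma; apply: ereal_sup_ubound; right; exists a. Qed.

Lemma last_passage_time_le x M b : (forall a, M a -> a <= b) ->
  (last_passage_time x M <= passage_time x b)%E.
Proof.
move=> Mb; apply: ge_ereal_sup => _ [->|[a Ma <-]]; first exact: passage_time_ge0.
exact/le_passage_time/Mb.
Qed.

(** The supremum of [M] need not belong to [M]: its level is reached as the limit
    of the passages at the levels of [M]. *)
Lemma at_last_passage_time x M b r : continuous_path x ->
  (forall a, M a -> 0 <= a) -> (forall a, M a -> a <= b) ->
  last_passage_time x M = r%:E -> x r = sup M.
Proof.
move=> px M0 Mb Sr; have r0 : 0 <= r by rewrite -lee_fin -Sr last_passage_time_ge0.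
have late s : 0 <= s -> s < r -> exists2 a, M a & (s%:E < passage_time x a)%E.
  move=> s0 sr; have : (s%:E < last_passage_time x M)%E by rewrite Sr lte_fin.
  move=> /ereal_sup_gt[_ [->|[a Ma <-]]]; first by rewrite lte_fin ltNge s0.
  by exists a.
have [M_empty|M_ne] := eqVneq M set0.
  have S0 : last_passage_time x M = 0%E.
    rewrite /last_passage_time M_empty image_set0 setU0; exact: ereal_sup1.
  by move: Sr; rewrite S0 M_empty sup0 => -[<-]; exact: (proj1 px).
have supM : has_sup M.
  by split; [exact/set0P|exists b; exact: Mb].
have le_sup a : M a -> a <= sup M by apply: sup_upper_bound.
have sup_ge0 : 0 <= sup M.
  by case: supM => -[a Ma] _; exact: le_trans (M0 _ Ma) (le_sup _ Ma).
have [xa|xa|//] := ltgtP (x r) (sup M); exfalso.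
- have [a Ma xra] : exists2 a, M a & x r < a.
    have e0 : 0 < sup M - x r by rewrite subr_gt0.
    by have [a Ma] := sup_adherent e0 supM; rewrite subKr; exists a.
  have /(continuous_path_near px r0)[h h0 xh] : 0 < a - x r by rewrite subr_gt0.
  have below s : 0 <= s -> `|s - r| < h -> x s < a.
    by move=> s0 /(xh _ s0); rewrite ltr_norml; lra.
  (* the path stays below [a] within [h] of [r], so a level of [M] above [a] that
     is reached by the time [r] is reached by the time [r - h] *)
  have reach a' : M a' -> a <= a' -> exists2 u, passage_time x a' = u%:E & 0 <= u <= r - h.
    move=> Ma' aa'; have := le_last_passage_time x Ma'; rewrite Sr.
    have := passage_time_ge0 x a'.
    case E : (passage_time x a') => [u||]//; rewrite !lee_fin => u0 ur.
    exists u => //; rewrite u0/= leNgt; apply/negP => rhu.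
    have xu := at_passage_time px (M0 _ Ma') E.
    have := below u u0; rewrite xu ltr_norml => /(_ _)/wrap[]; lra.
  have [u ua /andP[u0 urh]] := reach a Ma (lexx _).
  have [a' Ma' ra'] : exists2 a', M a' & ((r - h / 2)%:E < passage_time x a')%E.
    by apply: late; lra.
  have [aa'|/ltW a'a] := leP a a'.
    have [u' u'a /andP[_ u'rh]] := reach a' Ma' aa'.
    by move: ra'; rewrite u'a lte_fin; lra.
  have := le_passage_time x a'a; rewrite ua leNgt => /negP; apply.
  by rewrite (le_lt_trans _ ra')// lee_fin; lra.
- have rgt0 : 0 < r.
    rewrite lt_neqAle r0 andbT; apply/eqP => r0'.
    by move: xa; rewrite -r0' (proj1 px) ltNge sup_ge0.
  have /(continuous_path_near px r0)[h h0 xh] : 0 < x r - sup M by rewrite subr_gt0.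
  pose s := Num.max (r / 2) (r - h / 2).
  have [s1 s2] : r / 2 <= s /\ r - h / 2 <= s by split; rewrite le_max lexx ?orbT.
  have sr : s < r by rewrite gt_max; lra.
  have s0 : 0 < s by lra.
  have [a Ma /(before_passage s0) xsa] := late s (ltW s0) sr.
  have := le_sup _ Ma.
  have := xh s (ltW s0); rewrite !ltr_norml => /(_ _)/wrap[]; lra.
Qed.

End Paths.

(** * Sub-sigma-algebras and stopping times *)

Section SubSigma.
Context {R : realType} {d : measure_display} {T : measurableType d}.
Implicit Types (H : set (set T)) (f g : T -> R) (tau rho : T -> \bar R).

(** A sub-sigma-algebra given as a collection of sets is the sigma-algebra of a
    measurable type, which gives access to the measurability lemmas for it. *)
Lemma measurable_g_sigma H : sigma_algebra setT H ->
  (measurable : set (set (g_sigma_algebraType H))) = H.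
Proof. exact: measurable_g_measurableTypeE. Qed.

Lemma measurable_wrtP H f : sigma_algebra setT H ->
  measurable_wrt H f <-> measurable_fun setT (f : g_sigma_algebraType H -> R).
Proof.
move=> sH; split => [mf _ U mU|mf U mU].
  by rewrite setTI measurable_g_sigma//; exact: mf.
by rewrite -(measurable_g_sigma sH) -[X in measurable X]setTI; exact: mf.
Qed.

Lemma sub_sigma_setT H : sigma_algebra setT H -> H setT.
Proof. by move=> sH; rewrite -(measurable_g_sigma sH). Qed.

Lemma sub_sigma_setC H A : sigma_algebra setT H -> H A -> H (~` A).
Proof. by move=> sH; rewrite -(measurable_g_sigma sH); exact: measurableC. Qed.

Lemma sub_sigma_setI H A B : sigma_algebra setT H -> H A -> H B -> H (A `&` B).
Proof. by move=> sH; rewrite -(measurable_g_sigma sH); exact: measurableI. Qed.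

Lemma sub_sigma_setU H A B : sigma_algebra setT H -> H A -> H B -> H (A `|` B).
Proof. by move=> sH; rewrite -(measurable_g_sigma sH); exact: measurableU. Qed.

Lemma sub_sigma_setD H A B : sigma_algebra setT H -> H A -> H B -> H (A `\` B).
Proof. by move=> sH; rewrite -(measurable_g_sigma sH); exact: measurableD. Qed.

Lemma sub_sigma_bigcap H (A : nat -> set T) : sigma_algebra setT H ->
  (forall n, H (A n)) -> H (\bigcap_n A n).
Proof.
by move=> sH; rewrite -(measurable_g_sigma sH) => mA; exact: bigcapT_measurable.
Qed.

Lemma sub_sigma_bigcup H (A : nat -> set T) : sigma_algebra setT H ->
  (forall n, H (A n)) -> H (\bigcup_n A n).
Proof.
by move=> sH; rewrite -(measurable_g_sigma sH) => mA; exact: bigcupT_measurable.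
Qed.

Lemma measurable_wrt_rays H f : sigma_algebra setT H ->
  (forall x, H [set w | x < f w]) -> measurable_wrt H f.
Proof.
move=> sH mf; apply/(measurable_wrtP _ sH).
apply: (measurability _ (RGenOInfty.measurableE R)) => // _ [_ [x ->] <-].
rewrite setTI measurable_g_sigma// (_ : _ @^-1` _ = [set w | x < f w])//.
by apply/seteqP; split => w /=; rewrite in_itv/= andbT.
Qed.

Lemma measurable_wrt_comp H f (g : R -> R) :
  measurable_wrt H f -> measurable_fun setT g -> measurable_wrt H (g \o f).
Proof.
move=> mf mg U mU; rewrite comp_preimage; apply: mf.
by rewrite -[X in measurable X]setTI; exact: mg.
Qed.

Lemma measurable_wrtB H f g : sigma_algebra setT H ->
  measurable_wrt H f -> measurable_wrt H g -> measurable_wrt H (fun w => f w - g w).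
Proof.
move=> sH /(measurable_wrtP _ sH) mf /(measurable_wrtP _ sH) mg.
by apply/(measurable_wrtP _ sH); exact: measurable_funB.
Qed.

Lemma measurable_wrtM H f g : sigma_algebra setT H ->
  measurable_wrt H f -> measurable_wrt H g -> measurable_wrt H (fun w => f w * g w).
Proof.
move=> sH /(measurable_wrtP _ sH) mf /(measurable_wrtP _ sH) mg.
by apply/(measurable_wrtP _ sH); exact: measurable_funM.
Qed.

Lemma measurable_wrt_indic H E : sigma_algebra setT H -> H E -> measurable_wrt H (\1_E : T -> R).
Proof.
move=> sH HE; apply/(measurable_wrtP _ sH); apply: measurable_indic.
by rewrite measurable_g_sigma.
Qed.

Lemma measurable_wrt_capped H tau t : sigma_algebra setT H -> 0 <= t ->
  (forall w, 0 <= tau w)%E ->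
  (forall s, 0 <= s -> s < t -> H [set w | tau w <= s%:E]%E) ->
  measurable_wrt H (fun w => fine (mine t%:E (tau w))).
Proof.
move=> sH t0 tau0 mtau; apply: measurable_wrt_rays => // x.
have [x0|x0] := ltP x 0.
  rewrite (_ : [set _ | _] = setT); first exact: sub_sigma_setT.
  apply/seteqP; split => w //= _; apply: lt_le_trans x0 _.
  by rewrite fine_ge0// le_min lee_fin t0 tau0.
have [tx|xt] := leP t x.
  rewrite (_ : [set _ | _] = set0); first by case: sH.
  apply/seteqP; split => w //=; rewrite ltNge (le_trans _ tx)//.
  have := tau0 w; case: (tau w) => [r||]//= _; last by rewrite minEle leey.
  by rewrite -EFin_min/= ge_min lexx.
rewrite (_ : [set _ | _] = ~` [set w | tau w <= x%:E]%E).
  by apply: sub_sigma_setC => //; exact: mtau.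
apply/seteqP; split => w /=; have := tau0 w; case: (tau w) => [r||]//= _.
- by rewrite -EFin_min/= lt_min => /andP[_ xr]; apply/negP; rewrite lee_fin -ltNge.
- by rewrite -EFin_min/= lt_min xt/= => /negP; rewrite lee_fin -ltNge.
- by rewrite minEle leey.
Qed.

Definition stopping_time (F : R -> set (set T)) tau : Prop :=
  (forall w, 0 <= tau w)%E /\ forall t, 0 <= t -> F t [set w | tau w <= t%:E]%E.

(** The sigma-algebra of the past of [tau]. Measurability is required separately
    because the condition says nothing about the part of [A] on which [tau] is
    infinite. *)
Definition stopped_sigma (F : R -> set (set T)) tau : set (set T) :=
  [set A | measurable A /\ forall t, 0 <= t -> F t (A `&` [set w | tau w <= t%:E]%E)].

Section Stopped.
Variable F : R -> set (set T).
Hypothesis F_filtration : filtration F.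

Lemma filtration_sigma t : 0 <= t -> sigma_algebra setT (F t).
Proof. by case: F_filtration => + _; apply. Qed.

Lemma filtration_sub s t : 0 <= s -> s <= t -> F s `<=` F t.
Proof. by case: F_filtration => _ [_]; apply. Qed.

Lemma filtration_measurable t : 0 <= t -> F t `<=` measurable.
Proof. by case: F_filtration => _ [+ _]; apply. Qed.

Lemma stopped_sigma_algebra tau : stopping_time F tau ->
  sigma_algebra setT (stopped_sigma F tau).
Proof.
move=> [tau0 stau]; split.
- split=> // t t0; rewrite set0I; by case: (filtration_sigma t0).
- move=> A [mA FA]; split; first by rewrite setTD; exact: measurableC.
  move=> t t0; rewrite setTD (_ : _ `&` _ =
    [set w | tau w <= t%:E]%E `\` (A `&` [set w | tau w <= t%:E]%E)).
    by apply: sub_sigma_setD; [exact: filtration_sigma|exact: stau|exact: FA].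
  apply/seteqP; split => w /=; first by move=> [nA tw]; split => // -[].
  by move=> [tw nA]; split => // Aw; apply: nA.
- move=> A mA; split; first by apply: bigcupT_measurable => n; case: (mA n).
  move=> t t0; rewrite setI_bigcupl; apply: sub_sigma_bigcup => [|n].
    exact: filtration_sigma.
  by have [_] := mA n; apply.
Qed.

Lemma stopped_sigma_le tau rho : stopping_time F rho ->
  (forall w, tau w <= rho w)%E ->
  stopped_sigma F tau `<=` stopped_sigma F rho.
Proof.
move=> [_ srho] tr A [mA FA]; split => // t t0.
rewrite (_ : _ `&` _ = (A `&` [set w | tau w <= t%:E]%E) `&` [set w | rho w <= t%:E]%E).
  by apply: sub_sigma_setI; [exact: filtration_sigma|exact: FA|exact: srho].
apply/seteqP; split => w /=; last by case=> -[].
by move=> [Aw rt]; split => //; split=> //; exact: le_trans rt.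
Qed.

Lemma stopped_sigma_earlier tau rho s : stopping_time F tau -> stopping_time F rho ->
  (forall w, rho w <= tau w)%E -> 0 <= s ->
  stopped_sigma F tau [set w | rho w <= s%:E]%E.
Proof.
move=> [_ stau] [_ srho] rt s0; split.
  exact: (filtration_measurable s0 (srho _ s0)).
move=> t t0; have [st|/ltW ts] := leP s t.
  apply: sub_sigma_setI; [exact: filtration_sigma| |exact: stau].
  exact: (filtration_sub s0 st (srho _ s0)).
rewrite setIidr; first exact: stau.
by move=> w /= /(le_trans (rt w))/le_trans; apply; rewrite lee_fin.
Qed.

Lemma stopped_sigma_before tau A s : stopping_time F tau -> stopped_sigma F tau A ->
  0 <= s -> F s (A `&` [set w | tau w < s%:E]%E).
Proof.
move=> [tau0 _] [_ FA]; rewrite le_eqVlt => /predU1P[<-|s0].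
  rewrite (_ : _ `&` _ = set0); first by case: (filtration_sigma (lexx 0)).
  by apply/seteqP; split => w //= [_]; rewrite ltNge tau0.
pose u n := Num.max 0 (s - n.+1%:R^-1).
have u0 n : 0 <= u n by rewrite le_max lexx.
have us n : u n < s by rewrite gt_max s0/= gtrBl invr_gt0.
rewrite (_ : _ `&` _ = \bigcup_n (A `&` [set w | tau w <= (u n)%:E]%E)).
  apply: sub_sigma_bigcup => [|n]; first exact/filtration_sigma/ltW.
  by apply: (filtration_sub (u0 n) (ltW (us n))); exact: FA.
apply/seteqP; split => w /=; last first.
  by move=> [n _ [Aw tw]]; split => //; rewrite (le_lt_trans tw)// lte_fin.
move=> [Aw]; have := tau0 w; case E : (tau w) => [r||]//; rewrite lee_fin lte_fin => r0 rs.
have d0 : 0 < s - r by rewrite subr_gt0.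
have [n _ /(_ n (leqnn _)) /= nd] := near_infty_natSinv_lt (PosNum d0).
exists n => //; split=> //; rewrite /= E lee_fin le_max; apply/orP; right.
by move: nd; set v := n.+1%:R^-1; lra.
Qed.

Lemma measurable_capped tau t : stopping_time F tau -> 0 <= t ->
  measurable_wrt (F t) (fun w => fine (mine t%:E (tau w))).
Proof.
move=> [tau0 stau] t0; apply: measurable_wrt_capped => // [|s s0 st].
  exact: filtration_sigma.
exact: (filtration_sub s0 (ltW st) (stau _ s0)).
Qed.

Lemma measurable_elapsed tau t : stopping_time F tau -> 0 <= t ->
  measurable_wrt (F t) (fun w => elapsed (tau w) t).
Proof.
move=> stau t0; apply: (measurable_wrt_comp (measurable_capped stau t0) (g := fun x => t - x)).
by apply: measurable_funB.
Qed.

Lemma measurable_wrt_fun t f : 0 <= t -> measurable_wrt (F t) f -> measurable_fun setT f.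
Proof.
by move=> t0 mf _ U mU; rewrite setTI; apply: (filtration_measurable t0); exact: mf.
Qed.

End Stopped.
End SubSigma.

(** * Passage times of Brownian motion *)

Lemma cofinal_sequence {R : realType} (M : set R) : has_sup M ->
  exists u : nat -> R, (forall n, M (u n)) /\ forall a, M a -> exists n, a <= u n.
Proof.
move=> supM; have [Msup|Msup] := pselect (M (sup M)).
  exists (fun _ => sup M); split => // a Ma; exists 0%N.
  exact: sup_upper_bound.
have [u hu] : {u : nat -> R & forall n, M (u n) /\ sup M - n.+1%:R^-1 < u n}.
  apply: (@choice _ _ (fun n x => M x /\ sup M - n.+1%:R^-1 < x)) => n.
  have n0 : 0 < n.+1%:R^-1 :> R by rewrite invr_gt0.
  by have [x Mx] := sup_adherent n0 supM; exists x.
exists u; split=> [n|a Ma]; first by case: (hu n).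
have d0 : 0 < sup M - a.
  rewrite subr_gt0 lt_neqAle sup_upper_bound// andbT.
  by apply/eqP => aM; apply: Msup; rewrite -aM.
have [n _ /(_ n (leqnn _)) /= nd] := near_infty_natSinv_lt (PosNum d0).
exists n; have [_] := hu n; move: nd; set v := n.+1%:R^-1; lra.
Qed.

Section Passages.
Context {R : realType} {d : measure_display} {T : measurableType d}.
Variable B : R -> T -> R.
Implicit Types (F : R -> set (set T)) (M : set R).

Definition last_passage M (w : T) : \bar R := last_passage_time (B^~ w) M.

(** Passage times increase with the level, so a countable cofinal family of levels
    is enough. *)
Lemma stopping_time_last_passage F M b : filtration F ->
  (forall a, M a -> a <= b) ->
  (forall a, M a -> stopping_time F (first_passage B a)) ->
  stopping_time F (last_passage M).
Proof.
move=> FF Mb sM; split => [w|t t0]; first exact: last_passage_time_ge0.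
have sF := filtration_sigma FF t0.
have -> : [set w | last_passage M w <= t%:E]%E =
    [set w | forall a, M a -> first_passage B a w <= t%:E]%E.
  apply/seteqP; split => w /=.
    by move=> St a Ma; apply: le_trans St; exact: le_last_passage_time.
  move=> h; apply: ge_ereal_sup => _ [->|[a Ma <-]]; first by rewrite lee_fin.
  exact: h.
have [M0|/set0P M0] := eqVneq M set0.
  rewrite M0 (_ : [set _ | _] = setT); first exact: sub_sigma_setT.
  by apply/seteqP; split => // w _ a.
have [u [uM ule]] : exists u : nat -> R, (forall n, M (u n)) /\
    forall a, M a -> exists n, a <= u n.
  by apply: cofinal_sequence; split => //; exists b; exact: Mb.
rewrite (_ : [set _ | _] = \bigcap_n [set w | first_passage B (u n) w <= t%:E]%E).
  by apply: sub_sigma_bigcap => // n; have [_] := sM _ (uM n); apply.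
apply/seteqP; split => w /=; first by move=> h n _; exact: h.
move=> h a Ma; have [n /(le_passage_time (B^~ w)) aun] := ule _ Ma.
exact: le_trans aun (h n I).
Qed.

Variable P : probability T R.

(** In a sigma-algebra that contains the null sets, membership only depends on the
    trace on a set [Om] of full measure. *)
Lemma sub_sigma_mod_null (H : set (set T)) (Om A C : set T) : sigma_algebra setT H ->
  null_sets P `<=` H -> (forall N, N `<=` ~` Om -> null_sets P N) ->
  H A -> A `&` Om = C `&` Om -> H C.
Proof.
move=> sH NH NOm HA AC.
have -> : C = (A `\` (A `&` ~` Om)) `|` (C `&` ~` Om).
  rewrite setDIr setDv set0U setDE setCK AC -setIUr setUv setIT//.
apply: sub_sigma_setU => //; last by apply/NH/NOm; exact: subIsetr.
by apply: sub_sigma_setD => //; apply/NH/NOm; exact: subIsetr.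
Qed.

Variable G : R -> set (set T).
Hypothesis P_complete : measure_is_complete P.
Hypothesis G_filtration : filtration G.
Hypothesis G_usual : usual_conditions P G.
Hypothesis B_brownian : brownian_motion P G B.

(** The paths are continuous almost surely only. The arguments that need continuity
    take place on this set, whose complement is negligible. *)
Definition regular_paths : set T := [set w | continuous_path (B^~ w)].

Lemma null_outside_regular N : N `<=` ~` regular_paths -> null_sets P N.
Proof.
move=> Nsub; have [_ [B0 [Bc _]]] := B_brownian.
have neg : P.-negligible (~` regular_paths).
  have /= : {ae P, forall w, continuous_path (B^~ w)}.
    by apply: filterS2 B0 Bc => w; split.
  by [].
have negN : P.-negligible N := negligibleS Nsub neg.
have mN := P_complete negN; split => //.
by apply/negligibleP.
Qed.

Lemma measurable_regular : measurable regular_paths.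
Proof.
rewrite -[regular_paths]setCK; apply: measurableC.
by have [] := null_outside_regular (@subset_refl _ (~` regular_paths)).
Qed.

Lemma null_sub_G t : 0 <= t -> null_sets P `<=` G t.
Proof.
move=> t0; case: G_usual => _ N0; apply: subset_trans N0 _.
exact: (filtration_sub G_filtration (lexx 0) t0).
Qed.

Lemma passage_before_G a t : 0 <= t -> G t [set w | first_passage B a w < t%:E]%E.
Proof.
move=> t0; have sG := filtration_sigma G_filtration t0.
pose E (m k : nat) (q : rat) : set T :=
  if (m.+1%:R^-1 <= ratr q :> R) && (ratr q <= t - m.+1%:R^-1) then
    [set w | a - k.+1%:R^-1 < B (ratr q) w] else set0.
apply: (@sub_sigma_mod_null (G t) regular_paths
  (\bigcup_m \bigcap_k \bigcup_q E m k q)) => //.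
- exact: null_sub_G.
- exact: null_outside_regular.
- apply: sub_sigma_bigcup => // m; apply: sub_sigma_bigcap => // k.
  rewrite -(measurable_g_sigma sG); apply: bigcupT_measurable_rat => q.
  rewrite measurable_g_sigma// /E; case: ifPn => [/andP[q1 q2]|_]; last by case: sG.
  have q0 : 0 <= ratr q :> R by apply: le_trans q1; rewrite invr_ge0.
  have qt : ratr q <= t by apply: (le_trans q2); rewrite gerBl invr_ge0.
  apply: (filtration_sub G_filtration q0 qt).
  have [/(_ _ q0) mB _] := B_brownian.
  have := mB `]a - k.+1%:R^-1, +oo[%classic (measurable_itv _).
  by rewrite (_ : _ @^-1` _ = [set w | a - k.+1%:R^-1 < B (ratr q) w])//;
    apply/seteqP; split => w /=; rewrite in_itv/= andbT.
- apply/seteqP; split => w [Hw pw]; split => //.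
  + apply/passage_time_ltP => //; case: Hw => m _ hm; exists m => k.
    have [q _] := hm k I; rewrite /E; case: ifPn => // /andP[q1 q2] /= Bq.
    by exists q.
  + move: Hw => /(passage_time_ltP _ _ pw)[m hm]; exists m => // k _.
    by have [q [q1 q2 Bq]] := hm k; exists q => //; rewrite /E q1 q2.
Qed.

(** The filtration is right-continuous, so it is enough to observe whether the
    passage occurs strictly before each later time. *)
Lemma stopping_time_first_passage a : stopping_time G (first_passage B a).
Proof.
split => [w|t t0]; first exact: passage_time_ge0.
have [rc _] := G_usual; rewrite (rc _ t0) => u /= tu.
pose v n : R := Num.min u (t + n.+1%:R^-1).
have tv n : t < v n by rewrite lt_min tu /= ltrDl invr_gt0.
have vu n : v n <= u by rewrite ge_min lexx.
have u0 : 0 <= u by rewrite ltW// (le_lt_trans t0).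
rewrite (_ : [set _ | _] = \bigcap_n [set w | first_passage B a w < (v n)%:E]%E).
  apply: sub_sigma_bigcap => [|n]; first exact: filtration_sigma.
  have v0 : 0 <= v n by rewrite ltW// (le_lt_trans t0).
  apply: (filtration_sub G_filtration v0 (vu n)).
  exact: passage_before_G.
apply/seteqP; split => w /=.
  by move=> wt n _; apply: (le_lt_trans wt); rewrite lte_fin.
move=> h; apply/lee_addgt0Pr => e e0.
have [n _ /(_ n (leqnn _)) /= nd] := near_infty_natSinv_lt (PosNum e0).
rewrite (le_trans (ltW (h n I)))// -EFinD lee_fin ge_min; apply/orP; right.
by rewrite lerD2l ltW.
Qed.

End Passages.

(** * Integrals over events and independent variables *)

Section Integration.
Context {R : realType} {d : measure_display} {T : measurableType d}.
Variable P : probability T R.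

Lemma integral_mrestrT (C : set T) (mC : measurable C) (f : T -> \bar R) :
  measurable_fun setT f -> (forall w, 0 <= f w)%E ->
  (\int[mrestr P mC]_w f w = \int[P]_(w in C) f w)%E.
Proof.
move=> mf f0; have mC' : measurable (~` C) by exact: measurableC.
rewrite -(setUv C) ge0_integral_setU//; last 2 first.
- by rewrite setUv.
- by apply/disj_setPS; rewrite setICr.
rewrite [X in (_ + X)%E]null_set_integral//; last 2 first.
- exact: measurable_funTS.
- by rewrite /= /mrestr setICl measure0.
rewrite adde0; apply: eq_measure_integral => A mA AC.
by rewrite /= /mrestr setIidl.
Qed.

Lemma integral_independent (C : set T) (X : T -> measurableTypeR R)
    (nu : {measure set (measurableTypeR R) -> \bar R})
    (f : measurableTypeR R -> \bar R) :
  measurable C -> measurable_fun setT X ->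
  (forall U, measurable U -> P (C `&` X @^-1` U) = P C * nu U)%E ->
  measurable_fun setT f -> (forall x, 0 <= f x)%E ->
  (\int[P]_(w in C) f (X w) = P C * \int[nu]_x f x)%E.
Proof.
move=> mC mX CX mf f0.
have PC0 : 0 <= fine (P C) by rewrite fine_ge0.
have PCE : P C = (NngNum PC0)%:num%:E by rewrite /= fineK// fin_num_measure.
rewrite PCE -ge0_integral_mscale//.
rewrite -(integral_mrestrT mC) //; last exact: measurableT_comp.
have := @ge0_integral_pushforward _ _ _ _ R X mX (mrestr P mC) setT f
  measurableT mf (fun y _ => f0 y).
rewrite preimage_setT => <-.
apply: eq_measure_integral => U mU _ /=.
rewrite /pushforward /mrestr setIC CX// /mscale; congr (_ * _)%E; exact: PCE.
Qed.

Lemma cvg_integral_unit (nu : {measure set T -> \bar R}) (D : set T)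
    (f_ : nat -> T -> \bar R) (f : T -> \bar R) :
  measurable D -> (nu D < +oo)%E ->
  (forall n, measurable_fun D (f_ n)) -> measurable_fun D f ->
  {ae nu, forall w, D w -> f_ n w @[n --> \oo] --> f w} ->
  (forall n w, D w -> 0 <= f_ n w <= 1)%E ->
  (\int[nu]_(w in D) f_ n w @[n --> \oo] --> \int[nu]_(w in D) f w)%E.
Proof.
move=> mD nuD mf_ mf ff f01.
have i1 : nu.-integrable D (cst 1%E).
  apply/integrableP; split; first exact: measurable_cst.
  by under eq_integral do rewrite abse1; rewrite integral_cst// mul1e.
have f1 : {ae nu, forall w n, D w -> (`|f_ n w| <= cst 1 w)%E}.
  apply: aeW => w n Dw; have /andP[f0 f1] := f01 n w Dw.
  by rewrite gee0_abs.
by have [_ _] := dominated_convergence mD mf_ mf ff i1 f1.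
Qed.

End Integration.

(** * Discretized times and Gaussian increments *)

Section Grid.
Context {R : realType}.
Implicit Types (r : R) (n : nat).

(** The first point strictly after [r] of the grid of mesh 1/(n+1). A stopping time
    rounded up in this way takes countably many values, and each value is taken
    on an event that is known at that time. *)
Definition next_grid n r : R := (Num.truncn (n.+1%:R * r)).+1%:R / n.+1%:R.

Lemma next_grid_gt n r : 0 <= r -> r < next_grid n r.
Proof.
move=> r0; rewrite /next_grid ltr_pdivlMr// mulrC.
have nr0 : 0 <= n.+1%:R * r by rewrite mulr_ge0.
by have /andP[] := truncn_itv nr0.
Qed.

Lemma next_grid_le n r : 0 <= r -> next_grid n r <= r + n.+1%:R^-1.
Proof.
move=> r0; rewrite /next_grid ler_pdivrMr// mulrDl mulVf// -natr1 lerD2r mulrC.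
have nr0 : 0 <= n.+1%:R * r by rewrite mulr_ge0.
by have /andP[] := truncn_itv nr0; rewrite mulrC.
Qed.

Lemma next_grid_near r h : 0 <= r -> 0 < h ->
  \forall n \near \oo, r < next_grid n r < r + h.
Proof.
move=> r0 h0; near=> n; rewrite next_grid_gt//=.
apply: le_lt_trans (next_grid_le n r0) _; rewrite ltrD2l.
near: n; exact: near_infty_natSinv_lt (PosNum h0).
Unshelve. all: by end_near. Qed.

Lemma next_grid_cvg (r : R) : 0 <= r -> next_grid n r @[n --> \oo] --> r.
Proof.
move=> r0; apply/cvgrPdist_lt => e e0.
near=> n; have /andP[h1 h2] : r < next_grid n r < r + e.
  by near: n; exact: next_grid_near.
by rewrite ltr_norml; lra.
Unshelve. all: by end_near. Qed.

End Grid.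

Section StrongMarkov.
Context {R : realType} {d : measure_display} {T : measurableType d}.
Variables (P : probability T R) (G : R -> set (set T)) (B : R -> T -> R).
Hypothesis P_complete : measure_is_complete P.
Hypothesis G_filtration : filtration G.
Hypothesis B_brownian : brownian_motion P G B.

Lemma measurable_brownian t : 0 <= t -> measurable_fun setT (B t).
Proof.
move=> t0 _ U mU; rewrite setTI; have [/(_ _ t0 _ mU) + _] := B_brownian.
exact: filtration_measurable.
Qed.

Definition gauss_expectation (f : R -> R) r : \bar R :=
  (\int[normal_prob 0 (Num.sqrt r)]_x (f x)%:E)%E.

Lemma gauss_expectation_ge0 f r : (forall x, 0 <= f x) -> (0 <= gauss_expectation f r)%E.
Proof. by move=> f0; apply: integral_ge0 => x _; rewrite lee_fin. Qed.

Lemma gauss_expectation_le1 (f : R -> R) r : measurable_fun setT f ->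
  (forall x, 0 <= f x <= 1) -> (gauss_expectation f r <= 1)%E.
Proof.
move=> mf f01; apply: (@le_trans _ _ (\int[normal_prob 0 (Num.sqrt r)]_x (cst 1%E x))%E).
  apply: ge0_le_integral => //.
  - by move=> x _; rewrite lee_fin; case/andP: (f01 x).
  - exact/measurable_EFinP.
  - by move=> x _; rewrite lee_fin; case/andP: (f01 x).
by rewrite integral_cst//= mul1e probability_setT.
Qed.

Lemma brownian_increment C (f : R -> R) s t : 0 <= s -> s < t -> G s C ->
  measurable_fun setT f -> (forall x, 0 <= f x) ->
  (\int[P]_(w in C) (f (B t w - B s w))%:E = P C * gauss_expectation f (t - s))%E.
Proof.
move=> s0 st GC mf f0.
have mC : measurable C := filtration_measurable G_filtration s0 GC.
have t0 : 0 <= t by rewrite ltW// (le_lt_trans s0).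
have [_ [_ [_ [gauss indep]]]] := B_brownian.
rewrite (@integral_independent _ _ _ P C (fun w => B t w - B s w)
  (normal_prob 0 (Num.sqrt (t - s))) (fun x => (f x)%:E)) //.
- by apply: measurable_funB; exact: measurable_brownian.
- by move=> U mU; rewrite indep// gauss.
- exact/measurable_EFinP.
Qed.

(** Continuity of the paths gives continuity in [r] of the Gaussian expectation,
    which is the expectation of [f] at the increment of length [r]. *)
Lemma gauss_expectation_cvg (f : R -> R) (u : nat -> R) (r : R) :
  continuous f -> (forall x, 0 <= f x <= 1) -> (forall n, 0 < u n) -> 0 < r ->
  u n @[n --> \oo] --> r ->
  gauss_expectation f (u n) @[n --> \oo] --> gauss_expectation f r.
Proof.
move=> cf f01 u0 r0 ur.
have mf : measurable_fun setT f by exact: continuous_measurable_fun.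
have f0 x : 0 <= f x by case/andP: (f01 x).
have GT : G 0 setT := sub_sigma_setT (filtration_sigma G_filtration (lexx 0)).
have E t : 0 < t -> gauss_expectation f t = (\int[P]_w (f (B t w - B 0 w))%:E)%E.
  move=> t0; rewrite (brownian_increment (lexx 0) t0 GT)// subr0.
  by rewrite probability_setT mul1e.
rewrite E// (_ : (fun n => _) = (fun n => \int[P]_w (f (B (u n) w - B 0 w))%:E)%E); last first.
  by apply/funext => n; rewrite E.
have mfB t : 0 <= t -> measurable_fun setT (fun w => (f (B t w - B 0 w))%:E).
  move=> t0; apply/measurable_EFinP; apply: measurableT_comp => //.
  by apply: measurable_funB; exact: measurable_brownian.
apply: cvg_integral_unit => //.
- by rewrite -ge0_fin_numE//; exact: (fin_num_measure P).
- by move=> n; apply: mfB; exact: ltW.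
- by apply: mfB; exact: ltW.
- have [mN PN] := null_outside_regular P_complete B_brownian (@subset_refl _ (~` regular_paths B)).
  exists (~` regular_paths B); split => // w /= nh reg; apply: nh => _.
  apply: cvg_EFin; first exact: nearW.
  apply: (cvg_comp _ f); last exact: cf.
  apply: cvgB; last exact: cvg_cst.
  apply/cvgrPdist_lt => e e0.
  have [h h0 hB] := continuous_path_near reg (ltW r0) e0.
  move/cvgrPdist_lt : ur => /(_ _ h0); apply: filterS => n rn.
  by rewrite distrC; apply: hB; [exact: ltW|rewrite distrC].
- by move=> n w _; rewrite !lee_fin f01.
Qed.

End StrongMarkov.

(** * The strong Markov property at a passage time *)

Section HittingMarkov.
Context {R : realType} {d : measure_display} {T : measurableType d}.
Variables (P : probability T R) (G : R -> set (set T)) (B : R -> T -> R).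
Hypothesis P_complete : measure_is_complete P.
Hypothesis G_filtration : filtration G.
Hypothesis B_brownian : brownian_motion P G B.
Variables (tau : T -> \bar R) (y : R) (A : set T) (v : R).
Hypothesis tau_stopping : stopping_time G tau.
(** As the value at [tau] is a constant, the increment from [tau] to [v] is a
    function of the process at the fixed time [v] alone. *)
Hypothesis at_tau : forall w r, regular_paths B w -> tau w = r%:E -> B r w = y.
Hypothesis A_known : stopped_sigma G tau A.
Hypothesis v0 : 0 <= v.

Let D := A `&` [set w | tau w < v%:E]%E.

Let DE w : D w -> exists r, [/\ tau w = r%:E, 0 <= r & r < v].
Proof.
move=> [_ /=]; have := tau_stopping.1 w; case: (tau w) => [r||]//=.
by rewrite lee_fin lte_fin; exists r.
Qed.

Lemma measurable_before : measurable D.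
Proof.
exact: (filtration_measurable G_filtration v0
  (stopped_sigma_before G_filtration tau_stopping A_known v0)).
Qed.

Let cell n k := [set w | [/\ D w, Num.truncn (n.+1%:R * fine (tau w)) = k &
  k.+1%:R / n.+1%:R < v]].

Let cell_known n k : k.+1%:R / n.+1%:R < v -> G (k.+1%:R / n.+1%:R) (cell n k).
Proof.
move=> kv; set s := k.+1%:R / n.+1%:R; set s' := k%:R / n.+1%:R : R.
have s0 : 0 <= s by rewrite divr_ge0.
have s'0 : 0 <= s' by rewrite divr_ge0.
have ss' : s' <= s by rewrite ler_pM2r ?invr_gt0// ler_nat.
rewrite (_ : cell n k = (A `&` [set w | tau w < s%:E]%E) `\` (A `&` [set w | tau w < s'%:E]%E)).
  apply: sub_sigma_setD; first exact: filtration_sigma.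
    exact: stopped_sigma_before.
  apply: (filtration_sub G_filtration s'0 ss'); exact: stopped_sigma_before.
have inP (r : R) : 0 <= r -> (Num.truncn (n.+1%:R * r) == k) = (s' <= r < s).
  move=> r0; rewrite truncn_eq ?mulr_ge0// ler_pdivrMr// ltr_pdivlMr//.
  by rewrite [_ * r]mulrC.
apply/seteqP; split => w /=.
- move=> [Dw tk _]; have [r [tr r0 rv]] := DE Dw.
  move/eqP: tk; rewrite tr /= inP// => /andP[sr rs].
  split; first by split; [case: Dw|rewrite lte_fin].
  by move=> [_]; rewrite lte_fin ltNge sr.
- move=> [[Aw ts] ns]; have Dw : D w.
    by split => //=; rewrite (lt_trans ts)// lte_fin.
  have [r [tr r0 rv]] := DE Dw.
  split=> //; apply/eqP; rewrite tr /= inP//; move: ts ns; rewrite tr lte_fin => -> ns.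
  by rewrite andbT leNgt; apply/negP => rs'; apply: ns; split => //; rewrite lte_fin.
Qed.

Let measurable_cell n k : measurable (cell n k).
Proof.
have [kv|vk] := ltP (k.+1%:R / n.+1%:R) v.
  by apply: (filtration_measurable G_filtration _ (cell_known kv)); rewrite divr_ge0.
rewrite (_ : cell n k = set0)//; apply/seteqP; split => w //= [_ _].
by rewrite ltNge vk.
Qed.

Let cells n := \bigcup_k cell n k.

Let cellsP n w : cells n w <-> D w /\ next_grid n (fine (tau w)) < v.
Proof.
split => [[k _ [Dw tk kv]]|[Dw nv]]; first by rewrite /next_grid tk.
by exists (Num.truncn (n.+1%:R * fine (tau w))).
Qed.

Let cell_grid n k w : cell n k w -> next_grid n (fine (tau w)) = k.+1%:R / n.+1%:R.
Proof. by move=> [_ tk _]; rewrite /next_grid tk. Qed.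

Let measurable_cells n : measurable (cells n).
Proof. by apply: bigcupT_measurable => k. Qed.

Let cells_sub n : cells n `<=` D.
Proof. by move=> w /cellsP[]. Qed.

(** The strong Markov property at [tau] for the increment from [tau] to [v], on the
    events [A] of the past of [tau] and for one test function [f]. *)
Definition markov_test (f : R -> R) : Prop :=
  measurable_fun D (fun w => gauss_expectation f (v - fine (tau w))) /\
  (\int[P]_(w in D) (f (B v w - y))%:E =
   \int[P]_(w in D) gauss_expectation f (v - fine (tau w)))%E.

Let PD_fin (E : set T) : measurable E -> (P E < +oo)%E.
Proof. by move=> mE; rewrite -ge0_fin_numE//; exact: (fin_num_measure P). Qed.

Let measurable_at_v (f : R -> R) : measurable_fun setT f ->
  measurable_fun D (fun w => (f (B v w - y))%:E).
Proof.
move=> mf; apply/measurable_EFinP; apply: measurableT_comp => //.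
apply: measurable_funTS; apply: measurable_funB => //.
exact: (measurable_brownian G_filtration B_brownian).
Qed.

Section Discretized.
Variable f : R -> R.
Hypothesis cf : continuous f.
Hypothesis f01 : forall x, 0 <= f x <= 1.

Let mf : measurable_fun setT f. Proof. exact: continuous_measurable_fun. Qed.

Let f0 x : 0 <= f x. Proof. by case/andP: (f01 x). Qed.

Let left_ n w := (f (B v w - B (next_grid n (fine (tau w))) w))%:E.
Let right_ n w := gauss_expectation f (v - next_grid n (fine (tau w))).

Let measurable_left n : measurable_fun (cells n) (left_ n).
Proof.
apply/measurable_fun_bigcup => // k; have [kv|vk] := ltP (k.+1%:R / n.+1%:R) v.
  apply: (@eq_measurable_fun _ _ _ _ _
      (fun w => (f (B v w - B (k.+1%:R / n.+1%:R) w))%:E)).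
    by move=> w; rewrite inE => /cell_grid; rewrite /left_ => ->.
  apply/measurable_EFinP; apply: measurableT_comp => //; apply: measurable_funTS.
  by apply: measurable_funB; apply: (measurable_brownian G_filtration B_brownian);
    rewrite ?divr_ge0.
rewrite (_ : cell n k = set0); first exact: measurable_fun_set0.
by apply/seteqP; split => w //= [_ _]; rewrite ltNge vk.
Qed.

Let measurable_right n : measurable_fun (cells n) (right_ n).
Proof.
apply/measurable_fun_bigcup => // k.
apply: (@eq_measurable_fun _ _ _ _ _ (cst (gauss_expectation f (v - k.+1%:R / n.+1%:R)))).
  by move=> w; rewrite inE => /cell_grid; rewrite /right_ => ->.
exact: measurable_cst.
Qed.

(** On each cell the rounded time is a constant, so the independence of the
    increments after it applies. *)
Let integral_cells n :
  (\int[P]_(w in cells n) left_ n w = \int[P]_(w in cells n) right_ n w)%E.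
Proof.
have tr : trivIset setT (cell n).
  by move=> i j _ _ [w [[_ <- _] [_ <- _]]].
rewrite !ge0_integral_bigcup//.
- apply: eq_eseriesr => k _; have [kv|vk] := ltP (k.+1%:R / n.+1%:R) v; last first.
    rewrite (_ : cell n k = set0); first by rewrite !integral_set0.
    by apply/seteqP; split => w //= [_ _]; rewrite ltNge vk.
  transitivity (\int[P]_(w in cell n k) (f (B v w - B (k.+1%:R / n.+1%:R) w))%:E)%E.
    by apply: eq_integral => w; rewrite inE => /cell_grid; rewrite /left_ => ->.
  rewrite (brownian_increment G_filtration B_brownian _ kv (cell_known kv))// ?divr_ge0//.
  transitivity (\int[P]_(w in cell n k) gauss_expectation f (v - k.+1%:R / n.+1%:R))%E.
    by rewrite integral_cst// muleC.
  by apply: eq_integral => w; rewrite inE => /cell_grid; rewrite /right_ => ->.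
- exact: measurable_right.
- by move=> w _; exact: gauss_expectation_ge0.
- exact: measurable_left.
- by move=> w _; rewrite lee_fin.
Qed.

Let eventually_cells w : D w -> \forall n \near \oo, w \in cells n.
Proof.
move=> Dw; have [r [tr r0 rv]] := DE Dw.
have d0 : 0 < v - r by rewrite subr_gt0.
apply: filterS (next_grid_near r0 d0) => n /andP[_ h].
by rewrite inE; apply/cellsP; split => //; rewrite tr /=; lra.
Qed.

Let left_cvg w : D w -> regular_paths B w ->
  (left_ n \_ (cells n)) w @[n --> \oo] --> (f (B v w - y))%:E.
Proof.
move=> Dw reg; have [r [tr r0 rv]] := DE Dw.
apply: (@cvg_trans _ (left_ n w @[n --> \oo])).
  apply: near_eq_cvg; apply: filterS (eventually_cells Dw) => n wn.
  by rewrite patchE wn.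
apply: cvg_EFin; first exact: nearW.
apply: (cvg_comp _ f); last exact: cf.
apply: cvgB; first exact: cvg_cst.
rewrite tr /= -(at_tau reg tr); apply/cvgrPdist_lt => e e0.
have [h h0 hB] := continuous_path_near reg r0 e0.
have /cvgrPdist_lt/(_ _ h0) := next_grid_cvg r0; apply: filterS => n rn.
rewrite distrC; apply: hB; last by rewrite distrC.
by rewrite (le_trans r0)// ltW// next_grid_gt.
Qed.

Let right_cvg w : D w ->
  (right_ n \_ (cells n)) w @[n --> \oo] --> gauss_expectation f (v - fine (tau w)).
Proof.
move=> Dw; have [r [tr r0 rv]] := DE Dw.
pose u n := if next_grid n r < v then v - next_grid n r else v - r.
apply: (@cvg_trans _ (gauss_expectation f (u n) @[n --> \oo])).
  apply: near_eq_cvg; apply: filterS (eventually_cells Dw) => n wn.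
  rewrite patchE wn /right_ /u tr /=; move: wn; rewrite inE => /cellsP[_].
  by rewrite tr /= => ->.
rewrite tr /=; apply: (gauss_expectation_cvg P_complete G_filtration B_brownian) => //.
- by move=> n; rewrite /u; case: (ltP (next_grid n r) v) => h; rewrite subr_gt0.
- by rewrite subr_gt0.
- apply: (@cvg_trans _ (v - next_grid n r @[n --> \oo])).
    apply: near_eq_cvg; apply: filterS (eventually_cells Dw) => n.
    by rewrite inE => /cellsP[_]; rewrite tr /= /u => ->.
  by apply: cvgB; [exact: cvg_cst|exact: next_grid_cvg].
Qed.

(** Let the mesh of the grid tend to 0: continuity of the path at [tau] is used on
    the left, continuity of the Gaussian law in its variance on the right. *)
Lemma markov_test_continuous : markov_test f.
Proof.
have mD := measurable_before.
have restr (g : T -> \bar R) n :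
    (\int[P]_(w in D) (g \_ (cells n)) w = \int[P]_(w in cells n) g w)%E.
  by rewrite -integral_mkcondr setIidr//; exact: cells_sub.
have mrestr_ (g : T -> \bar R) n :
    measurable_fun (cells n) g -> measurable_fun D (g \_ (cells n)).
  move=> mg; apply/(measurable_restrict _ (measurable_cells n) mD).
  by rewrite setIidr//; exact: cells_sub.
have restr01 (g : T -> \bar R) n w : (0 <= g w <= 1)%E -> (0 <= (g \_ (cells n)) w <= 1)%E.
  by rewrite patchE; case: ifP => // _ _; rewrite lexx lee01.
have lr n : (\int[P]_(w in D) (left_ n \_ (cells n)) w =
    \int[P]_(w in D) (right_ n \_ (cells n)) w)%E.
  by rewrite !restr; exact: integral_cells.
have mright : measurable_fun D (fun w => gauss_expectation f (v - fine (tau w))).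
  apply: (@emeasurable_fun_cvg _ _ _ D (fun n => right_ n \_ (cells n))) => [n|w Dw].
    by apply: mrestr_; exact: measurable_right.
  exact: right_cvg.
split => //.
have cvgl : (\int[P]_(w in D) (left_ n \_ (cells n)) w @[n --> \oo] -->
    \int[P]_(w in D) (f (B v w - y))%:E)%E.
  apply: cvg_integral_unit => //.
  - exact: PD_fin.
  - by move=> n; apply: mrestr_; exact: measurable_left.
  - exact: measurable_at_v.
  - have [mN PN] := null_outside_regular P_complete B_brownian
      (@subset_refl _ (~` regular_paths B)).
    exists (~` regular_paths B); split => // w /= nh reg; apply: nh => Dw.
    exact: left_cvg.
  - by move=> n w Dw; apply: restr01; rewrite !lee_fin.
have cvgr : (\int[P]_(w in D) (right_ n \_ (cells n)) w @[n --> \oo] -->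
    \int[P]_(w in D) gauss_expectation f (v - fine (tau w)))%E.
  apply: cvg_integral_unit => //.
  - exact: PD_fin.
  - by move=> n; apply: mrestr_; exact: measurable_right.
  - by apply: aeW => w Dw; exact: right_cvg.
  - move=> n w Dw; apply: restr01.
    by rewrite gauss_expectation_ge0//= gauss_expectation_le1.
move: cvgl; rewrite (_ : (fun n => _) = (fun n => \int[P]_(w in D) (right_ n \_ (cells n)) w)%E).
  by move=> cvgl; exact: (cvg_unique _ cvgl cvgr).
by apply/funext.
Qed.

End Discretized.

(** The passage to the limit that reaches indicators of open sets, for which the
    discretization itself need not converge. *)
Lemma markov_test_limit (f_ : nat -> R -> R) (f : R -> R) :
  (forall n, measurable_fun setT (f_ n)) -> (forall n x, 0 <= f_ n x <= 1) ->
  (forall x, f_ n x @[n --> \oo] --> f x) -> (forall n, markov_test (f_ n)) ->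
  markov_test f.
Proof.
move=> mf_ f01 ff mk.
have mD := measurable_before.
have mf : measurable_fun setT f by apply: (@measurable_fun_cvg _ _ _ setT f_).
have gcvg r : gauss_expectation (f_ n) r @[n --> \oo] --> gauss_expectation f r.
  apply: cvg_integral_unit => //.
  - by rewrite -ge0_fin_numE//; exact: fin_num_measure.
  - by move=> n; apply/measurable_EFinP; exact: mf_.
  - exact/measurable_EFinP.
  - by apply: aeW => x _; apply: cvg_EFin; [exact: nearW|exact: ff].
  - by move=> n x _; rewrite !lee_fin.
have mright : measurable_fun D (fun w => gauss_expectation f (v - fine (tau w))).
  apply: (@emeasurable_fun_cvg _ _ _ D
    (fun n w => gauss_expectation (f_ n) (v - fine (tau w)))) => [n|w Dw].
    by case: (mk n).
  exact: gcvg.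
split => //.
have cvgl : (\int[P]_(w in D) (f_ n (B v w - y))%:E @[n --> \oo] -->
    \int[P]_(w in D) (f (B v w - y))%:E)%E.
  apply: cvg_integral_unit => //.
  - exact: PD_fin.
  - by move=> n; exact: measurable_at_v.
  - exact: measurable_at_v.
  - by apply: aeW => w _; apply: cvg_EFin; [exact: nearW|exact: ff].
  - by move=> n w _; rewrite !lee_fin.
have cvgr : (\int[P]_(w in D) gauss_expectation (f_ n) (v - fine (tau w)) @[n --> \oo] -->
    \int[P]_(w in D) gauss_expectation f (v - fine (tau w)))%E.
  apply: cvg_integral_unit => //.
  - exact: PD_fin.
  - by move=> n; case: (mk n).
  - by apply: aeW => w _; exact: gcvg.
  - move=> n w _; rewrite gauss_expectation_ge0 ?gauss_expectation_le1// => x.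
    by case/andP: (f01 n x).
move: cvgl; rewrite (_ : (fun n => _) = (fun n =>
    \int[P]_(w in D) gauss_expectation (f_ n) (v - fine (tau w)))%E).
  by move=> cvgl; exact: (cvg_unique _ cvgl cvgr).
by apply/funext => n; case: (mk n).
Qed.

End HittingMarkov.

(** * The reflection principle *)

Section Ramp.
Context {R : realType}.

Definition ramp (n : nat) (z : R) : R := Num.min 1 (n%:R * Num.max 0 z).

Lemma ramp01 n z : 0 <= ramp n z <= 1.
Proof.
by rewrite /ramp le_min ler01 ge_min lexx andbT mulr_ge0// le_max lexx.
Qed.

Lemma continuous_ramp n : continuous (ramp n).
Proof.
move=> z; have c0 : {for z, continuous (fun z : R => Num.max 0 z : R^o)}.
  by apply: (@continuous_max _ _ (fun=> 0) id); [exact: cvg_cst|exact: cvg_id].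
have -> : ramp n = (fun=> 1) \min (fun z => n%:R * Num.max 0 z) by [].
by apply: continuous_min; [exact: cvg_cst|exact: cvgMr].
Qed.

Lemma ramp_cvg (z : R) : ramp n z @[n --> \oo] --> ((0 < z)%R%:R : R).
Proof.
apply: cvg_near_cst; have [z0|z0] := ltP 0 z; last first.
  by apply: nearW => n; rewrite /ramp max_l// mulr0 min_r.
near=> n; rewrite /ramp max_r ?ltW// min_l//.
rewrite -ler_pdivrMr// div1r; near: n; exact: nbhs_infty_ger.
Unshelve. all: by end_near. Qed.

End Ramp.

Section HalfLines.
Context {R : realType} {d : measure_display} {T : measurableType d}.
Variables (P : probability T R) (G : R -> set (set T)) (B : R -> T -> R).
Hypothesis P_complete : measure_is_complete P.
Hypothesis G_filtration : filtration G.
Hypothesis B_brownian : brownian_motion P G B.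
Variables (tau : T -> \bar R) (y : R) (A : set T) (v : R).
Hypothesis tau_stopping : stopping_time G tau.
Hypothesis at_tau : forall w r, regular_paths B w -> tau w = r%:E -> B r w = y.
Hypothesis A_known : stopped_sigma G tau A.
Hypothesis v0 : 0 <= v.

Let D := A `&` [set w | tau w < v%:E]%E.

Lemma strong_markov_test (U : set R) : measurable U -> markov_test P B tau y A v \1_U ->
  measurable_fun D (fun w => normal_prob 0 (Num.sqrt (v - fine (tau w))) U) /\
  P (D `&` [set w | U (B v w - y)]) =
  (\int[P]_(w in D) normal_prob 0 (Num.sqrt (v - fine (tau w))) U)%E.
Proof.
move=> mU [m1 m2].
have GE r : gauss_expectation \1_U r = normal_prob 0 (Num.sqrt r) U.
  by rewrite /gauss_expectation integral_indic// setIT.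
split; first by under eq_fun do rewrite -GE.
under eq_integral do rewrite -GE.
have mD : measurable D.
  exact: (measurable_before G_filtration tau_stopping A_known v0).
have mX : measurable [set w | U (B v w - y)].
  have : measurable_fun setT (fun w => B v w - y).
    by apply: measurable_funB => //; exact: (measurable_brownian G_filtration B_brownian).
  by move=> /(_ measurableT _ mU); rewrite setTI.
rewrite -m2 setIC -integral_indic//.
Qed.

(** Ramps approximate the indicator of the open set where [g] is positive. *)
Lemma strong_markov_pos (g : R -> R) (U : set R) : continuous g ->
  (forall x, U x <-> 0 < g x) -> measurable U ->
  measurable_fun D (fun w => normal_prob 0 (Num.sqrt (v - fine (tau w))) U) /\
  P (D `&` [set w | U (B v w - y)]) =
  (\int[P]_(w in D) normal_prob 0 (Num.sqrt (v - fine (tau w))) U)%E.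
Proof.
move=> cg Ug mU; apply: strong_markov_test => //.
have cramp n : continuous (fun x => ramp n (g x)).
  by move=> x; apply: (cvg_comp _ (ramp n)); [exact: cg|exact: continuous_ramp].
apply: (markov_test_limit G_filtration B_brownian tau_stopping A_known v0
  (f_ := fun n x => ramp n (g x))).
- by move=> n; exact: continuous_measurable_fun.
- by move=> n x; exact: ramp01.
- move=> x; suff -> : \1_U x = (0 < g x)%R%:R :> R by exact: (@ramp_cvg R).
  rewrite indicE; congr (_%:R); congr nat_of_bool.
  by apply/idP/idP; rewrite inE => /Ug.
- move=> n; apply: (markov_test_continuous P_complete G_filtration B_brownian
    tau_stopping at_tau A_known v0) => //.
  by move=> x; exact: ramp01.
Qed.

Lemma strong_markov_above c :
  measurable_fun D (fun w => normal_prob 0 (Num.sqrt (v - fine (tau w))) `]c, +oo[) /\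
  P (D `&` [set w | c < B v w - y]) =
  (\int[P]_(w in D) normal_prob 0 (Num.sqrt (v - fine (tau w))) `]c, +oo[)%E.
Proof.
have -> : [set w | c < B v w - y] = [set w | `]c, +oo[%classic (B v w - y)].
  by apply/seteqP; split => w /=; rewrite in_itv/= andbT.
apply: (@strong_markov_pos (fun x => x - c)) => //.
- by move=> x; apply: cvgB; [exact: cvg_id|exact: cvg_cst].
- by move=> x /=; rewrite in_itv/= andbT subr_gt0.
Qed.

Lemma strong_markov_below c :
  measurable_fun D (fun w => normal_prob 0 (Num.sqrt (v - fine (tau w))) `]-oo, c[) /\
  P (D `&` [set w | B v w - y < c]) =
  (\int[P]_(w in D) normal_prob 0 (Num.sqrt (v - fine (tau w))) `]-oo, c[)%E.
Proof.
have -> : [set w | B v w - y < c] = [set w | `]-oo, c[%classic (B v w - y)].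
  by apply/seteqP; split => w /=; rewrite in_itv/=.
apply: (@strong_markov_pos (fun x => c - x)) => //.
- by move=> x; apply: cvgB; [exact: cvg_cst|exact: cvg_id].
- by move=> x /=; rewrite in_itv/= subr_gt0.
Qed.

End HalfLines.

Section Reflection.
Context {R : realType} {d : measure_display} {T : measurableType d}.
Variables (P : probability T R) (G : R -> set (set T)) (B : R -> T -> R).
Hypothesis P_complete : measure_is_complete P.
Hypothesis G_filtration : filtration G.
Hypothesis G_usual : usual_conditions P G.
Hypothesis B_brownian : brownian_motion P G B.
Variables (M : set R) (b : R).
Hypothesis M_ge0 : forall a, M a -> 0 <= a.
Hypothesis M_le : forall a, M a -> a <= b.
Hypothesis sup_lt : sup M < b.

Let S := last_passage B M.
Let Tb := first_passage B b.
Let c := b - sup M.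

Let c0 : 0 < c. Proof. by rewrite subr_gt0. Qed.

Let b0 : 0 <= b.
Proof.
apply: le_trans (ltW sup_lt); have [M0|/set0P[a Ma]] := eqVneq M set0.
  by rewrite M0 sup0.
apply: le_trans (M_ge0 Ma) _; apply: sup_upper_bound => //.
by split; [exists a|exists b; exact: M_le].
Qed.

Lemma stopping_time_last_passage_G : stopping_time G S.
Proof.
apply: (@stopping_time_last_passage _ _ _ _ _ _ b) => // a _.
exact: (stopping_time_first_passage P_complete G_filtration G_usual B_brownian).
Qed.

Let stopping_Tb : stopping_time G Tb.
Proof. exact: (stopping_time_first_passage P_complete G_filtration G_usual B_brownian). Qed.

Let S_le_Tb w : (S w <= Tb w)%E.
Proof. exact: last_passage_time_le. Qed.

Let at_S w r : regular_paths B w -> S w = r%:E -> B r w = sup M.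
Proof. by move=> reg; apply: (at_last_passage_time reg M_ge0 M_le). Qed.

Let at_Tb w r : regular_paths B w -> Tb w = r%:E -> B r w = b.
Proof. by move=> reg; exact: at_passage_time. Qed.

(** This is where the gap below [b] enters: the path is at the level [sup M] at the
    time [S], hence not at [b]. *)
Let S_lt_Tb w r : regular_paths B w -> S w = r%:E -> (S w < Tb w)%E.
Proof.
move=> reg Sr; rewrite lt_neqAle S_le_Tb andbT; apply/eqP => ST.
have := at_S reg Sr; rewrite (at_Tb reg); last by rewrite -ST.
by move=> bM; move: sup_lt; rewrite bM ltxx.
Qed.

Lemma prob_eq_regular (X Y : set T) : measurable X -> measurable Y ->
  X `&` regular_paths B = Y `&` regular_paths B -> P X = P Y.
Proof.
move=> mX mY XY; have mO := measurable_regular P_complete B_brownian.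
have PO Z : measurable Z -> P Z = P (Z `&` regular_paths B).
  move=> mZ; rewrite (measureDI P mZ mO) [X in (X + _)%E](_ : _ = 0%E) ?add0e//.
  by have [|] := @null_outside_regular _ _ _ B P G P_complete B_brownian (Z `\` regular_paths B).
by rewrite PO// XY -PO.
Qed.

Variables (A : set T) (v : R).
Hypothesis A_known : stopped_sigma G S A.
Hypothesis v0 : 0 <= v.

Let A_known_Tb : stopped_sigma G Tb A.
Proof. exact: (stopped_sigma_le G_filtration stopping_Tb S_le_Tb). Qed.

Let mA : measurable A. Proof. by case: A_known. Qed.

Let measurable_lt (tau : T -> \bar R) s : stopping_time G tau -> 0 <= s ->
  measurable [set w | (tau w < s%:E)%E].
Proof.
move=> st s0; have GT : stopped_sigma G tau setT.
  exact: (sub_sigma_setT (stopped_sigma_algebra G_filtration st)).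
have := stopped_sigma_before G_filtration st GT s0; rewrite setTI.
exact: (filtration_measurable G_filtration s0).
Qed.

Let measurable_gt (tau : T -> \bar R) s : stopping_time G tau -> 0 <= s ->
  measurable [set w | (s%:E < tau w)%E].
Proof.
move=> [_ st] s0; rewrite (_ : [set _ | _] = ~` [set w | tau w <= s%:E]%E).
  exact: measurableC (filtration_measurable G_filtration s0 (st _ s0)).
by apply/seteqP; split => w /=; rewrite ltNge => /negP.
Qed.

Let measurable_B (p : R -> bool) : measurable [set x | p x] -> measurable [set w | p (B v w)].
Proof.
move=> mp; have := measurable_brownian G_filtration B_brownian v0.
by move=> /(_ measurableT _ mp); rewrite setTI.
Qed.

Lemma measurable_passage_survival :
  measurable_fun setT (fun w => (passage_survival c (elapsed (S w) v))%:E).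
Proof.
apply/measurable_EFinP; apply: measurableT_comp.
  exact: continuous_measurable_fun (continuous_passage_survival c0).
apply: (measurable_wrt_fun G_filtration v0); apply: (measurable_elapsed G_filtration) => //.
exact: stopping_time_last_passage_G.
Qed.

(** At the time [v] the paths that are below [b] either have not yet passed [b], or
    have passed it before. By symmetry at the passage time the second part has
    the same probability as the paths above [b], all of which have passed [b].
    The strong Markov property at [S] evaluates both sides. *)
Lemma reflection : 0 < v ->
  P (A `&` [set w | S w < v%:E]%E `&` [set w | v%:E < Tb w]%E) =
  (\int[P]_(w in A `&` [set w | S w < v%:E]%E)
     (passage_survival c (v - fine (S w)))%:E)%E.
Proof.
move=> vgt0; set DS := A `&` [set w | S w < v%:E]%E.
set DT := A `&` [set w | Tb w < v%:E]%E.
have mDS : measurable DS.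
  apply: measurableI => //; apply: measurable_lt => //.
  exact: stopping_time_last_passage_G.
have mDT : measurable DT by apply: measurableI => //; exact: measurable_lt.
have [mSa PSa] := strong_markov_above P_complete G_filtration B_brownian
  stopping_time_last_passage_G at_S A_known v0 c.
have [mSb PSb] := strong_markov_below P_complete G_filtration B_brownian
  stopping_time_last_passage_G at_S A_known v0 c.
have [_ PTa] := strong_markov_above P_complete G_filtration B_brownian
  stopping_Tb at_Tb A_known_Tb v0 0.
have [_ PTb] := strong_markov_below P_complete G_filtration B_brownian
  stopping_Tb at_Tb A_known_Tb v0 0.
have eB : [set w | B v w - sup M < c] = [set w | B v w < b].
  by apply/seteqP; split => w /=; rewrite /c; lra.
have eA : [set w | c < B v w - sup M] = [set w | b < B v w].
  by apply/seteqP; split => w /=; rewrite /c; lra.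
have eB0 : [set w | B v w - b < 0] = [set w | B v w < b].
  by apply/seteqP; split => w /=; lra.
have eA0 : [set w | 0 < B v w - b] = [set w | b < B v w].
  by apply/seteqP; split => w /=; lra.
rewrite eB in PSb; rewrite eA in PSa; rewrite eB0 in PTb; rewrite eA0 in PTa.
rewrite -/DS in PSa PSb mSa mSb; rewrite -/DT in PTa PTb.
have mBb : measurable [set w | B v w < b] 
  by apply: (@measurable_B (fun x => x < b)); have := @measurable_itv R `]-oo, b[; rewrite set_itvE.
have mbB : measurable [set w | b < B v w] 
  by apply: (@measurable_B (fun x => b < x)); have := @measurable_itv R `]b, +oo[; rewrite set_itvE.
have sym : P (DT `&` [set w | b < B v w]) = P (DT `&` [set w | B v w < b]).
  rewrite PTa PTb; apply: eq_integral => w; rewrite inE => -[_ /=].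
  move=> wv; rewrite normal_prob_half_lines// gt_eqF// sqrtr_gt0 subr_gt0.
  have := stopping_Tb.1 w; move: wv; case: (Tb w) => [r||]//=.
have same : P (DT `&` [set w | b < B v w]) = P (DS `&` [set w | b < B v w]).
  apply: prob_eq_regular; [exact: measurableI|exact: measurableI|].
  apply/seteqP; split => w /= [[[Aw wv] bB] reg]; split => //; split => //; split => //.
    exact: le_lt_trans (S_le_Tb w) wv.
  rewrite /= lt_neqAle passage_time_le// ?ltW// andbT; apply/eqP => Tv.
  by move: bB; rewrite (at_Tb reg Tv) ltxx.
set Q := DS `&` [set w | v%:E < Tb w]%E.
have mQ : measurable Q by apply: measurableI => //; exact: measurable_gt.
have split_ : P (DS `&` [set w | B v w < b]) = (P Q + P (DT `&` [set w | (B v w < b)%R]))%E.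
  rewrite -measureU//; last 2 first.
  - exact: measurableI.
  - apply/seteqP; split => w //= [[_ /= h1] [[_ /= h2] _]].
    by have := lt_trans h1 h2; rewrite ltxx.
  apply: prob_eq_regular; [exact: measurableI| |].
    by apply: measurableU => //; exact: measurableI.
  apply/seteqP; split => w /=.
  - move=> [[[Aw Sv] Bb] reg]; split => //.
    have [Tv|Tv|Tv] := ltgtP (Tb w) v%:E; first by right.
      by left.
    by move: Bb; rewrite (at_Tb reg Tv) ltxx.
  - move=> [[[[Aw Sv] vT]|[[Aw Tv] Bb]] reg]; split => //; split => //.
      exact: before_passage vT.
    by split => //; exact: le_lt_trans (S_le_Tb w) Tv.
have decomp : P (DS `&` [set w | B v w < b]) = (P (DS `&` [set w | (b < B v w)%R]) +
    \int[P]_(w in DS) (passage_survival c (v - fine (S w)))%:E)%E.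
  rewrite PSb PSa.
  transitivity (\int[P]_(w in DS)
      (normal_prob 0 (Num.sqrt (v - fine (S w))) `]c, +oo[ +
       (passage_survival c (v - fine (S w)))%:E))%E.
    apply: eq_integral => w; rewrite inE => -[_ /= Sv].
    rewrite normal_prob_survival// subr_gt0.
    by have := last_passage_time_ge0 (B^~ w) M; move: Sv;
      rewrite -/(last_passage B M w) -/(S w); case: (S w) => [r||].
  apply: (ge0_integralD P mDS _ mSa).
  - by move=> w _; exact: measure_ge0.
  - by move=> w _; rewrite lee_fin ltW// passage_survival_gt0.
  - apply: (@eq_measurable_fun _ _ _ _ _ (fun w => (passage_survival c (elapsed (S w) v))%:E)).
      move=> w; rewrite inE => -[_ /= Sv].
      by rewrite elapsed_after ?last_passage_time_ge0// ltW.
    apply: measurable_funTS; exact: measurable_passage_survival.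
move: decomp; rewrite split_ -sym same => h.
have finN : P (DS `&` [set w | (b < B v w)%R]) \is a fin_num.
  by apply: fin_num_measure; exact: measurableI.
by rewrite -[LHS](addeK _ finN) h addeAC subee// add0e.
Qed.

(** As long as [S] has not occurred the elapsed time is 0 and the passage at [b] is
    still to come, which extends [reflection] from the event [S < v] to the whole
    of [A]. *)
Lemma passage_law : P (A `&` [set w | v%:E < Tb w]%E) =
  (\int[P]_(w in A) (passage_survival c (elapsed (S w) v))%:E)%E.
Proof.
set DS := A `&` [set w | S w < v%:E]%E; set DS' := A `&` [set w | v%:E <= S w]%E.
have mDS : measurable DS.
  apply: measurableI => //; apply: measurable_lt => //.
  exact: stopping_time_last_passage_G.
have mDS' : measurable DS'.
  rewrite (_ : DS' = A `\` DS); first exact: measurableD.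
  apply/seteqP; split => w /=; first by move=> [Aw vS]; split => // -[_ /=]; rewrite ltNge vS.
  by move=> [Aw nS]; split => //; rewrite /= leNgt; apply/negP => Sv; apply: nS.
have ADS : A = DS `|` DS'.
  apply/seteqP; split => w; last by case=> -[].
  by move=> Aw; have [vS|Sv] := leP v%:E (S w); [right|left].
have dis : DS `&` DS' = set0.
  by apply/seteqP; split => w // [[_ /= Sv] [_ /=]]; rewrite leNgt Sv.
have mQ : measurable [set w | v%:E < Tb w]%E by exact: measurable_gt.
rewrite {1}ADS setIUl measureU; last 3 first.
- exact: measurableI.
- exact: measurableI.
- by apply/seteqP; split => w // [[[_ /= Sv] _] [[_ /= vS] _]]; move: vS; rewrite leNgt Sv.
rewrite [in RHS]ADS ge0_integral_setU//; last 3 first.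
- by apply: measurable_funTS; exact: measurable_passage_survival.
- by move=> w _; rewrite lee_fin ltW// passage_survival_gt0.
- by apply/disj_setPS; rewrite dis.
congr (_ + _)%E.
  have [vgt0|v00] := ltP 0 v.
    apply: (etrans (reflection vgt0)); apply: eq_integral => w; rewrite inE => -[_ /= Sv].
    by rewrite elapsed_after ?last_passage_time_ge0// ltW.
  have -> : DS = set0.
    apply/seteqP; split => w //= [_ Sv]; have := last_passage_time_ge0 (B^~ w) M.
    by rewrite leNgt (lt_le_trans Sv)// lee_fin.
  by rewrite set0I measure0 integral_set0.
transitivity (P DS').
  apply: prob_eq_regular => //; first exact: measurableI.
  apply/seteqP; split => w /=; first by move=> [[]].
  move=> [[Aw vS] reg]; split => //; split => //=.
  have [S_fin|] := boolP (S w \is a fin_num).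
    by apply: le_lt_trans vS _; exact: (S_lt_Tb reg (esym (fineK S_fin))).
  rewrite ge0_fin_numE ?last_passage_time_ge0// -leNgt => yS.
  by apply: lt_le_trans (S_le_Tb w); exact: lt_le_trans (ltry v) yS.
transitivity (\int[P]_(w in DS') (cst 1%E w))%E.
  by rewrite integral_cst// mul1e.
apply: eq_integral => w; rewrite inE => -[_ /= vS].
by rewrite elapsed_before// passage_survival0.
Qed.

End Reflection.

(** * Conditioning with weights *)

Section Tonelli.
Context {R : realType} {d : measure_display} {T : measurableType d}.
Variable P : probability T R.
Notation mu := (@lebesgue_measure R).

Lemma tonelli_on (A : set T) (I : set (measurableTypeR R))
    (g : T * measurableTypeR R -> \bar R) :
  measurable A -> measurable I -> measurable_fun setT g -> (forall p, 0 <= g p)%E ->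
  (\int[P]_(w in A) \int[mu]_(x in I) g (w, x) =
   \int[mu]_(x in I) \int[P]_(w in A) g (w, x))%E.
Proof.
move=> mA mI mg g0; pose G := g \_ (A `*` I).
have mG : measurable_fun setT G.
  apply/(measurable_restrict _ (measurableX mA mI) measurableT).
  by rewrite setTI; exact: measurable_funTS.
have G0 p : (0 <= G p)%E by rewrite /G patchE; case: ifP.
have h := @fubini_tonelli _ _ _ _ R P mu G mG G0.
transitivity (\int[P]_w \int[mu]_x G (w, x))%E.
  rewrite integral_mkcond; apply: eq_integral => w _.
  rewrite patchE; case: ifPn => wA; last first.
    rewrite integral0_eq// => x _; rewrite /G patchE; case: ifP => //.
    by rewrite inE => -[/= /mem_set]; rewrite (negbTE wA).
  rewrite integral_mkcond; apply: eq_integral => x _; rewrite /G !patchE.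
  congr (if _ then _ else _); apply/idP/idP; rewrite !inE => //; last by case.
  by move=> xI; split => //=; move: wA; rewrite inE.
rewrite h [RHS]integral_mkcond; apply: eq_integral => x _.
rewrite patchE; case: ifPn => xI; last first.
  rewrite integral0_eq// => w _; rewrite /G patchE; case: ifP => //.
  by rewrite inE => -[/= _ /mem_set]; rewrite (negbTE xI).
rewrite [RHS]integral_mkcond; apply: eq_integral => w _; rewrite /G !patchE.
congr (if _ then _ else _); apply/idP/idP; rewrite !inE => //; first by case.
by move=> wA; split => //=; move: xI; rewrite inE.
Qed.

(** Writing [phi] as the integral of the indicators of its superlevel sets reduces
    weighted integrals to integrals over events. *)
Lemma layer_cake (A : set T) (phi Y : T -> R) :
  measurable A -> measurable_fun setT phi -> (forall w, 0 <= phi w) ->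
  measurable_fun setT Y -> (forall w, 0 <= Y w) ->
  (\int[P]_(w in A) (phi w * Y w)%:E =
   \int[mu]_(x in `[0%R, +oo[) \int[P]_(w in A `&` [set w | x < phi w]%R) (Y w)%:E)%E.
Proof.
move=> mA mphi phi0 mY Y0.
pose g (p : T * measurableTypeR R) : \bar R := if p.2 < phi p.1 then (Y p.1)%:E else 0%E.
have mg : measurable_fun setT g.
  apply: measurable_fun_ifT => //.
    apply: measurable_fun_ltr; first exact: measurable_snd.
    by apply: measurableT_comp => //; exact: measurable_fst.
  by apply/measurable_EFinP; apply: measurableT_comp => //; exact: measurable_fst.
have g0 p : (0 <= g p)%E by rewrite /g; case: ifP => // _; rewrite lee_fin.
transitivity (\int[P]_(w in A) \int[mu]_(x in `[0%R, +oo[) g (w, x))%E.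
  apply: eq_integral => w _.
  transitivity (\int[mu]_(x in `[0%R, phi w[) (Y w)%:E)%E.
    rewrite integral_cst//= lebesgue_measure_itv/= lte_fin.
    have := phi0 w; rewrite le_eqVlt => /predU1P[<-|->].
      by rewrite ltxx mule0 mul0r.
    by rewrite oppr0 adde0 -EFinM mulrC.
  rewrite (_ : `[0%R, phi w[%classic = `[0%R, +oo[ `&` [set x | x < phi w]); last first.
    by apply/seteqP; split => x /=; rewrite !in_itv/= andbT; [move=> /andP|move=> [-> ->]].
  rewrite integral_mkcondr; apply: eq_integral => x _.
  by rewrite patchE /g /=; congr (if _ then _ else _); apply/idP/idP; rewrite inE.
rewrite tonelli_on//; apply: eq_integral => x _.
rewrite integral_mkcondr; apply: eq_integral => w _.
by rewrite patchE /g /=; congr (if _ then _ else _); apply/idP/idP; rewrite inE.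
Qed.

(** Two variables with the same conditional expectation given [H] keep it after
    multiplication by a nonnegative variable known in [H]. *)
Lemma integral_weighted (H : set (set T)) (phi Y Z : T -> R) (A : set T) :
  sigma_algebra setT H -> H `<=` measurable ->
  measurable_wrt H phi -> (forall w, 0 <= phi w) ->
  measurable_fun setT Y -> (forall w, 0 <= Y w) ->
  measurable_fun setT Z -> (forall w, 0 <= Z w) ->
  (forall E, H E -> \int[P]_(w in E) (Y w)%:E = \int[P]_(w in E) (Z w)%:E)%E ->
  H A -> (\int[P]_(w in A) (phi w * Y w)%:E = \int[P]_(w in A) (phi w * Z w)%:E)%E.
Proof.
move=> sH Hm mphi phi0 mY Y0 mZ Z0 YZ HA.
have mphi' : measurable_fun setT phi.
  by move=> _ U mU; rewrite setTI; apply: Hm; exact: mphi.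
rewrite !layer_cake//; [|exact: Hm..].
apply: eq_integral => x _; apply: YZ; apply: sub_sigma_setI => //.
have := mphi `]x, +oo[%classic (measurable_itv _).
by rewrite (_ : _ @^-1` _ = [set w | x < phi w])//;
  apply/seteqP; split => w /=; rewrite in_itv/= andbT.
Qed.

End Tonelli.

(** * The integrated hazard rate *)

Section Cumulative.
Context {R : realType}.
Variable c : R.
Hypothesis c0 : 0 < c.
Implicit Types (S U : \bar R) (r s t : R).
Notation mu := (@lebesgue_measure R).

Definition cumulative_hazard r : R := - ln (passage_survival c r).

Lemma cumulative_hazard0 : cumulative_hazard 0 = 0.
Proof. by rewrite /cumulative_hazard passage_survival0 ln1 oppr0. Qed.

Lemma continuous_cumulative_hazard : continuous cumulative_hazard.
Proof.
move=> r; apply: cvgN; apply: (cvg_comp _ (@ln R)); first exact: continuous_passage_survival.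
by apply: continuous_ln; exact: passage_survival_gt0.
Qed.

Lemma is_derive_cumulative_hazard r : 0 < r ->
  is_derive r 1 cumulative_hazard (passage_hazard c r).
Proof.
move=> r0.
have d1 := is_derive1_comp (is_derive1_ln (passage_survival_gt0 c0 r))
  (is_derive_passage_survival c0 r0).
apply: (is_derive_eq (is_deriveN d1)).
by rewrite mulrN opprK mulrC.
Qed.

Lemma continuous_capped U : (0 <= U)%E -> continuous (fun s => fine (mine s%:E U)).
Proof.
move=> U0; have [U_fin|] := boolP (U \is a fin_num).
  have -> : (fun s => fine (mine s%:E U)) = id \min (fun=> fine U).
    by apply/funext => s; rewrite -[in LHS](fineK U_fin) -EFin_min.
  by move=> s; apply: continuous_min; [exact: cvg_id|exact: cvg_cst].
rewrite ge0_fin_numE// -leNgt leye_eq => /eqP->.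
rewrite (_ : (fun _ => _) = id); first by move=> s; exact: cvg_id.
by apply/funext => s; rewrite min_l// leey.
Qed.

Lemma continuous_elapsed S : (0 <= S)%E -> continuous (elapsed S).
Proof. by move=> S0 s; apply: cvgB; [exact: cvg_id|exact: continuous_capped]. Qed.

Definition hazard_until S U s : R :=
  if (s%:E < U)%E then passage_hazard c (elapsed S s) else 0.

Lemma hazard_until_ge0 S U s : 0 <= hazard_until S U s.
Proof. by rewrite /hazard_until; case: ifP => // _; exact: passage_hazard_ge0. Qed.

Lemma integral_hazard_until S U t : (0 <= S)%E -> (0 <= U)%E -> 0 <= t ->
  (\int[mu]_(s in `[0%R, t]) (hazard_until S U s)%:E =
   (cumulative_hazard (elapsed S (fine (mine t%:E U))))%:E)%E.
Proof.
move=> S0 U0 t0.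
have FTC u : 0 <= u -> (\int[mu]_(s in `[0%R, u]) (passage_hazard c (elapsed S s))%:E =
    (cumulative_hazard (elapsed S u))%:E)%E.
  move=> u0; have := integral_elapsed (continuous_passage_hazard c0)
    continuous_cumulative_hazard (@passage_hazard0 _ c) is_derive_cumulative_hazard S0 u0.
  by rewrite cumulative_hazard0 subr0.
have [tU|Ut] := ltP t%:E U.
  rewrite -FTC//; apply: eq_integral => s; rewrite inE/= in_itv/= => /andP[_ st].
  by rewrite /hazard_until (le_lt_trans _ tU)// lee_fin.
have [r Ur] : exists r, U = r%:E.
  by move: U U0 Ut => [r||]//; exists r.
move: Ut U0; rewrite Ur /= !lee_fin => rt r0.
rewrite -FTC//.
transitivity (\int[mu]_(s in `[0%R, r[) (passage_hazard c (elapsed S s))%:E)%E.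
  rewrite (_ : `[0%R, r[%classic = `[0%R, t] `&` [set s | s < r]); last first.
    apply/seteqP; split => s /=; rewrite !in_itv/=.
      by move=> /andP[s0 sr]; rewrite s0 (le_trans (ltW sr)).
    by move=> [/andP[-> _]].
  rewrite integral_mkcondr; apply: eq_integral => s _.
  rewrite patchE /hazard_until lte_fin; case: (ltP s r) => sr.
    by rewrite mem_set.
  by rewrite memNset//=; apply/negP; rewrite -leNgt.
rewrite integral_itv_bndo_bndc//; apply/measurable_EFinP; apply: measurableT_comp.
  exact: continuous_measurable_fun (continuous_passage_hazard c0).
by apply: measurable_funTS; apply: continuous_measurable_fun; exact: continuous_elapsed.
Qed.

(** Puts the clock of the compensator in a form that only involves the stopping
    times capped at [t], which are known at the time [t]. *)
Lemma elapsed_capped S U t : (0 <= S)%E -> (S <= U)%E -> 0 <= t ->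
  elapsed S (fine (mine t%:E U)) = fine (mine t%:E U) - fine (mine t%:E S).
Proof.
move=> S0 SU t0; have U0 := le_trans S0 SU; congr (_ - fine _).
rewrite fineK; first by rewrite -minA [mine U S]min_r.
rewrite ge0_fin_numE ?le_min ?lee_fin ?t0//.
rewrite minEle; case: ifP => [_|/negbT]; first exact: ltry.
by rewrite -ltNge => /lt_trans; apply; exact: ltry.
Qed.

End Cumulative.

(** * Compensation given the past of the lower passages *)

Section Joint.
Context {R : realType} {d : measure_display} {T : measurableType d}.
Implicit Types (S U : T -> \bar R).

Lemma measurable_stopping_time (F : R -> set (set T)) S : filtration F ->
  stopping_time F S -> measurable_fun setT S.
Proof.
move=> FF [S0 sS]; apply: (measurability _ (ErealGenOInfty.measurableE R)) => // _ [_ [x ->] <-].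
rewrite setTI; have [x0|x0] := ltP x 0.
  rewrite (_ : _ @^-1` _ = setT)//; apply/seteqP; split => w //= _.
  by rewrite in_itv/= andbT (lt_le_trans _ (S0 w))// lte_fin.
rewrite (_ : _ @^-1` _ = ~` [set w | S w <= x%:E]%E).
  exact: measurableC (filtration_measurable FF x0 (sS _ x0)).
apply/seteqP; split => w /=; rewrite in_itv/= andbT; first by move=> h; apply/negP; rewrite -ltNge.
by move=> /negP; rewrite -ltNge.
Qed.

Lemma measurable_joint_elapsed S : measurable_fun setT S ->
  measurable_fun setT (fun p : T * measurableTypeR R => elapsed (S p.1) p.2).
Proof.
move=> mS; apply: measurable_funB; first exact: measurable_snd.
apply: (@measurableT_comp _ _ _ _ _ _ fine _
  (fun p : T * measurableTypeR R => mine p.2%:E (S p.1))).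
  exact: fine_measurable.
apply: measurable_mine; first by apply/measurable_EFinP; exact: measurable_snd.
by apply: measurableT_comp => //; exact: measurable_fst.
Qed.

Lemma measurable_joint_hazard c S U : 0 < c ->
  measurable_fun setT S -> measurable_fun setT U ->
  measurable_fun setT
    (fun p : T * measurableTypeR R => hazard_until c (S p.1) (U p.1) p.2).
Proof.
move=> c0 mS mU; apply: measurable_fun_ifT => //.
- apply: measurable_fun_lte; first by apply/measurable_EFinP; exact: measurable_snd.
  by apply: measurableT_comp => //; exact: measurable_fst.
- apply: measurableT_comp; last exact: measurable_joint_elapsed.
  exact: continuous_measurable_fun (continuous_passage_hazard c0).
Qed.

End Joint.

Section Compensator.
Context {R : realType} {d : measure_display} {T : measurableType d}.
Variables (P : probability T R) (G : R -> set (set T)) (B : R -> T -> R).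
Hypothesis P_complete : measure_is_complete P.
Hypothesis G_filtration : filtration G.
Hypothesis G_usual : usual_conditions P G.
Hypothesis B_brownian : brownian_motion P G B.
Variables (M : set R) (b : R).
Hypothesis M_ge0 : forall a, M a -> 0 <= a.
Hypothesis M_le : forall a, M a -> a <= b.
Hypothesis sup_lt : sup M < b.
Notation mu := (@lebesgue_measure R).

Let S := last_passage B M.
Let Tb := first_passage B b.
Let c := b - sup M.

Let c0 : 0 < c. Proof. by rewrite subr_gt0. Qed.

Let stopping_S : stopping_time G S.
Proof. exact: (stopping_time_last_passage_G P_complete G_filtration G_usual B_brownian M_le). Qed.

Let stopping_Tb : stopping_time G Tb.
Proof. exact: (stopping_time_first_passage P_complete G_filtration G_usual B_brownian). Qed.

Let S0 w : (0 <= S w)%E. Proof. exact: last_passage_time_ge0. Qed.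
Let Tb0 w : (0 <= Tb w)%E. Proof. exact: passage_time_ge0. Qed.

Let known_sigma : sigma_algebra setT (stopped_sigma G S).
Proof. exact: stopped_sigma_algebra. Qed.

Let law A v := passage_law P_complete G_filtration G_usual B_brownian
  M_ge0 M_le sup_lt (A := A) (v := v).

Lemma measurable_elapsed_S v : 0 <= v ->
  measurable_wrt (stopped_sigma G S) (fun w => elapsed (S w) v).
Proof.
move=> v0; have m := @measurable_wrt_capped _ _ _ (stopped_sigma G S) S v known_sigma v0 S0.
apply: (measurable_wrt_comp (m _) (g := fun x => v - x)); last exact: measurable_funB.
by move=> s s0 _; exact: stopped_sigma_earlier.
Qed.

Let known_measurable : stopped_sigma G S `<=` measurable.
Proof. by move=> A []. Qed.

Lemma measurable_elapsed_ST v : 0 <= v -> measurable_fun setT (fun w => elapsed (S w) v).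
Proof.
move=> v0 _ U mU; rewrite setTI; apply: known_measurable.
exact: measurable_elapsed_S.
Qed.

(** Given the past of [S], being not yet passed at the time [v] has the probability
    [passage_survival], and the hazard rate times the survival function is the
    density. *)
Lemma density_hazard A v : stopped_sigma G S A -> 0 <= v ->
  (\int[P]_(w in A) (passage_density c (elapsed (S w) v))%:E =
   \int[P]_(w in A) (hazard_until c (S w) (Tb w) v)%:E)%E.
Proof.
move=> AS v0.
have mTb : measurable [set w | v%:E < Tb w]%E.
  rewrite (_ : [set _ | _] = ~` [set w | Tb w <= v%:E]%E).
    exact: measurableC (filtration_measurable G_filtration v0 (stopping_Tb.2 _ v0)).
  by apply/seteqP; split => w /=; rewrite ltNge => /negP.
have -> : (fun w => (passage_density c (elapsed (S w) v))%:E) =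
    (fun w => (passage_hazard c (elapsed (S w) v) * passage_survival c (elapsed (S w) v))%:E).
  by apply/funext => w; rewrite passage_hazardK.
have -> : (fun w => (hazard_until c (S w) (Tb w) v)%:E) =
    (fun w => (passage_hazard c (elapsed (S w) v) * \1_[set w | v%:E < Tb w]%E w)%:E).
  apply/funext => w; rewrite /hazard_until indicE; case: ifPn => vT.
    by rewrite mem_set ?mulr1.
  by rewrite memNset ?mulr0//=; exact/negP.
apply: (integral_weighted known_sigma known_measurable) => //.
- apply: (measurable_wrt_comp (measurable_elapsed_S v0)).
  exact: continuous_measurable_fun (continuous_passage_hazard c0).
- by move=> w; exact: passage_hazard_ge0.
- apply: measurableT_comp; last exact: measurable_elapsed_ST.
  exact: continuous_measurable_fun (continuous_passage_survival c0).
- by move=> w; rewrite ltW// passage_survival_gt0.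
- move=> E ES; have mE := known_measurable ES.
  by rewrite integral_indic// setIC; apply/esym; exact: law.
Qed.

(** The compensation holds on every event of the past of [S], whatever the time [t]:
    the past of [S] can be revealed at the time 0 without changing the
    compensator. *)
Lemma compensation A t : stopped_sigma G S A -> 0 <= t ->
  P (A `&` [set w | Tb w <= t%:E]%E) =
  (\int[P]_(w in A)
     (cumulative_hazard c (elapsed (S w) (fine (mine t%:E (Tb w)))))%:E)%E.
Proof.
move=> AS t0; have mA := known_measurable AS.
have mS := measurable_stopping_time G_filtration stopping_S.
have mT := measurable_stopping_time G_filtration stopping_Tb.
have mTt : measurable [set w | Tb w <= t%:E]%E.
  exact: (filtration_measurable G_filtration t0 (stopping_Tb.2 _ t0)).
have msurv : measurable_fun setT (fun w => passage_survival c (elapsed (S w) t)).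
  apply: measurableT_comp; last exact: measurable_elapsed_ST.
  exact: continuous_measurable_fun (continuous_passage_survival c0).
transitivity (\int[P]_(w in A) (1 - passage_survival c (elapsed (S w) t))%:E)%E.
  have e1 : P A = (\int[P]_(w in A) (passage_survival c (elapsed (S w) t))%:E +
      \int[P]_(w in A) (1 - passage_survival c (elapsed (S w) t))%:E)%E.
    rewrite -[LHS]mul1e -integral_cst//.
    transitivity (\int[P]_(w in A) ((passage_survival c (elapsed (S w) t))%:E +
      (1 - passage_survival c (elapsed (S w) t))%:E))%E.
      by apply: eq_integral => w _; rewrite -EFinD addrC subrK.
    apply: ge0_integralD => //.
    - by move=> w _; rewrite lee_fin ltW// passage_survival_gt0.
    - by apply: measurable_funTS; exact/measurable_EFinP.
    - by move=> w _; rewrite lee_fin subr_ge0 passage_survival_le1.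
    - by apply: measurable_funTS; apply/measurable_EFinP; exact: measurable_funB.
  have e2 : P A = (P (A `&` [set w | t%:E < Tb w]%E) + P (A `&` [set w | Tb w <= t%:E]%E))%E.
    rewrite (measureDI P mA mTt) addeC [in RHS]addeC; congr (_ + P _)%E.
    by apply/seteqP; split => w [Aw /=]; rewrite ltNge => /negP.
  have fin : P (A `&` [set w | t%:E < Tb w]%E) \is a fin_num.
    apply: fin_num_measure; rewrite (_ : _ `&` _ = A `\` [set w | Tb w <= t%:E]%E).
      exact: measurableD.
    by apply/seteqP; split => w [Aw /=]; rewrite ltNge => /negP.
  rewrite -[LHS](addeK _ fin) [X in (X - _)%E]addeC -e2 e1 -law//.
  by rewrite addeAC subee// add0e.
transitivity (\int[P]_(w in A)
    \int[mu]_(v in `[0%R, t]) (passage_density c (elapsed (S w) v))%:E)%E.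
  apply: eq_integral => w _.
  have cneg : continuous (fun r => - passage_survival c r).
    by move=> r; apply: cvgN; exact: continuous_passage_survival.
  have dneg (r : R) : 0 < r ->
      is_derive r 1 (fun r => - passage_survival c r) (passage_density c r).
    move=> r0; rewrite -[passage_density c r]opprK.
    by apply: is_deriveN; exact: is_derive_passage_survival.
  rewrite (integral_elapsed (continuous_passage_density c0) cneg
    (@passage_density0 _ c) dneg (S0 w) t0).
  by rewrite passage_survival0 opprK addrC.
transitivity (\int[P]_(w in A)
    \int[mu]_(v in `[0%R, t]) (hazard_until c (S w) (Tb w) v)%:E)%E; last first.
  by apply: eq_integral => w _; rewrite integral_hazard_until.
(* exchanging the integrals turns the claim into one about each fixed time *)
rewrite (tonelli_on P (g := fun p => (passage_density c (elapsed (S p.1) p.2))%:E))//;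
  last 2 first.
- apply/measurable_EFinP; apply: measurableT_comp; last exact: measurable_joint_elapsed.
  exact: continuous_measurable_fun (continuous_passage_density c0).
- by move=> p; rewrite lee_fin passage_density_ge0.
rewrite (tonelli_on P (g := fun p => (hazard_until c (S p.1) (Tb p.1) p.2)%:E))//;
  last 2 first.
- by apply/measurable_EFinP; exact: measurable_joint_hazard.
- by move=> p; rewrite lee_fin hazard_until_ge0.
apply: eq_integral => v; rewrite inE/= in_itv/= => /andP[v0 _].
exact: density_hazard.
Qed.

End Compensator.

(** * The filtration of the passage times *)

Lemma norm_sub_unit {R : realType} (x y z : R) :
  0 <= x <= 1 -> 0 <= y -> y <= z -> `|x - y| <= 1 + z.
Proof. by move=> /andP[x0 x1] y0 yz; rewrite ler_norml; apply/andP; split; lra. Qed.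

Section PassageFiltration.
Context {R : realType} {d : measure_display} {T : measurableType d}.
Variables (P : probability T R) (G : R -> set (set T)) (B : R -> T -> R).
Hypothesis P_complete : measure_is_complete P.
Hypothesis G_filtration : filtration G.
Hypothesis G_usual : usual_conditions P G.
Hypothesis B_brownian : brownian_motion P G B.
Variables (L : set R) (b : R).
Hypothesis L_ge0 : forall x, L x -> 0 <= x.
Notation mu := (@lebesgue_measure R).

Let FF := passage_filtration P B L.

Let stopping_first a : stopping_time G (first_passage B a).
Proof. exact: (stopping_time_first_passage P_complete G_filtration G_usual B_brownian). Qed.

Lemma filtration_passage : filtration FF.
Proof.
split; first by move=> t t0; exact: smallest_sigma_algebra.
split=> [t t0|s t s0 st].
  apply: smallest_sub; first exact: sigma_algebra_measurable.
  move=> E [|[]//]; move=> /(_ (t + 1)) /=; rewrite ltrDl => /(_ ltr01).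
  apply: smallest_sub; first exact: sigma_algebra_measurable.
  move=> _ [x [r [Lx r0 rs ->]]].
  exact: (filtration_measurable G_filtration r0 ((stopping_first x).2 _ r0)).
apply: sub_sigma_algebra2 => E [hE|]; last by right.
by left=> u /= tu; apply: hE => /=; exact: le_lt_trans tu.
Qed.

Lemma stopping_first_F a : L a -> stopping_time FF (first_passage B a).
Proof.
move=> La; split=> [w|t t0]; first exact: passage_time_ge0.
apply: sub_sigma_algebra; left => u /= tu; apply: sub_sigma_algebra.
by exists a, t; split => //; exact: ltW.
Qed.

Let M := [set a | L a /\ a < b].
Hypothesis Lb : L b.
Hypothesis sup_lt : sup M < b.

Let M_ge0 a : M a -> 0 <= a. Proof. by case=> /L_ge0. Qed.
Let M_le a : M a -> a <= b. Proof. by case=> _ /ltW. Qed.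

Let S := last_passage B M.
Let Tb := first_passage B b.
Let c := b - sup M.

Let c0 : 0 < c. Proof. by rewrite subr_gt0. Qed.

Let stopping_S_F : stopping_time FF S.
Proof.
apply: (stopping_time_last_passage filtration_passage M_le) => a [La _].
exact: stopping_first_F.
Qed.

Let stopping_S_G : stopping_time G S.
Proof. by apply: (stopping_time_last_passage G_filtration M_le) => a _. Qed.

Let stopping_Tb_F : stopping_time FF Tb. Proof. exact: stopping_first_F. Qed.

Let S0 w : (0 <= S w)%E. Proof. exact: last_passage_time_ge0. Qed.
Let Tb0 w : (0 <= Tb w)%E. Proof. exact: passage_time_ge0. Qed.
Let S_le_Tb w : (S w <= Tb w)%E. Proof. exact: last_passage_time_le. Qed.

Let known := stopped_sigma G S.
Let known_sigma : sigma_algebra setT known.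
Proof. exact: stopped_sigma_algebra. Qed.
Let known_measurable : known `<=` measurable. Proof. by move=> A []. Qed.

(** The reason why the observation of the higher levels does not matter: as long as
    [b] has not been passed they have not been passed either, while the passages
    at the lower levels all belong to the past of [S]. Null sets belong to the
    past of [S] as well. *)
Lemma trace_before_passage s u : 0 <= s -> s < u -> forall E, FF s E ->
  exists2 A, known A & E `&` [set w | u%:E < Tb w]%E = A `&` [set w | u%:E < Tb w]%E.
Proof.
move=> s0 su; have u0 : 0 <= u by rewrite ltW// (le_lt_trans s0).
pose V := [set w | u%:E < Tb w]%E.
pose K := [set E | exists2 A, known A & E `&` V = A `&` V].
have sK : sigma_algebra setT K.
  split.
  - by exists set0 => //; case: known_sigma.
  - move=> E [A kA EA]; exists (~` A); first exact: sub_sigma_setC.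
    rewrite setTD; apply/seteqP; split => w /= [nE Vw]; split=> // Aw; apply: nE.
      by have : (A `&` V) w by []; rewrite -EA => -[].
    by have : (E `&` V) w by []; rewrite EA => -[].
  - move=> E hE; have [A hA] : {A : nat -> set T &
        forall n, known (A n) /\ E n `&` V = A n `&` V}.
      by apply: (@choice _ _ (fun n A => known A /\ E n `&` V = A `&` V)) => n;
        have [A kA EA] := hE n; exists A.
    exists (\bigcup_n A n); first by apply: sub_sigma_bigcup => // n; case: (hA n).
    by rewrite !setI_bigcupl; apply: eq_bigcupr => n _; case: (hA n).
suff FK : FF s `<=` K by move=> E /FK.
apply: smallest_sub => // E [hE|[mE PE]].
  suff sub : passage_filtration0 B L u `<=` K by exact: sub (hE u su).
  apply: smallest_sub => // _ [x [r [Lx r0 ru ->]]].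
  have [xb|bx] := ltP x b.
    exists [set w | first_passage B x w <= r%:E]%E => //.
    apply: (stopped_sigma_earlier G_filtration stopping_S_G (stopping_first x)) => // w.
    exact: le_last_passage_time.
  exists set0; first by case: known_sigma.
  rewrite set0I; apply/seteqP; split => w //= [xr uT].
  have := le_trans (le_passage_time (B^~ w) bx) xr.
  by rewrite leNgt (le_lt_trans _ uT)// lee_fin.
exists E => //; split => // t t0; apply: sub_sigma_setI.
- exact: filtration_sigma.
- exact: (null_sub_G G_filtration G_usual t0).
- exact: stopping_S_G.2.
Qed.

Let intensity s w := hazard_until c (S w) (Tb w) s.
Let compensator t w := cumulative_hazard c (elapsed (S w) (fine (mine t%:E (Tb w)))).

Let integral_intensity t w : 0 <= t ->
  (\int[mu]_(s in `[0%R, t]) (intensity s w)%:E = (compensator t w)%:E)%E.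
Proof. by move=> t0; exact: integral_hazard_until. Qed.

Let RintegralE t w : 0 <= t -> \int[mu]_(s in `[0, t]) intensity s w = compensator t w.
Proof. by move=> t0; rewrite /Rintegral integral_intensity. Qed.

Let measurable_S : measurable_fun setT S.
Proof. exact: (measurable_stopping_time G_filtration stopping_S_G). Qed.
Let measurable_Tb : measurable_fun setT Tb.
Proof. exact: (measurable_stopping_time G_filtration (stopping_first b)). Qed.

Lemma adapted_intensity : adapted FF intensity.
Proof.
move=> t t0; have sF := filtration_sigma filtration_passage t0.
have -> : intensity t = (fun w =>
    passage_hazard c (elapsed (S w) t) * \1_(~` [set w | Tb w <= t%:E]%E) w).
  apply/funext => w; rewrite /intensity /hazard_until indicE; case: ltP => vT.
    by rewrite mem_set ?mulr1//=; apply/negP; rewrite -ltNge.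
  by rewrite memNset ?mulr0//=; move=> h; apply: h.
apply: measurable_wrtM => //.
  apply: (@measurable_wrt_comp _ _ _ _ (fun w => elapsed (S w) t) (passage_hazard c)).
    exact: (measurable_elapsed filtration_passage).
  exact: (continuous_measurable_fun (continuous_passage_hazard c0)).
apply: (measurable_wrt_indic sF); apply: (sub_sigma_setC sF).
exact: stopping_Tb_F.2.
Qed.

Lemma adapted_compensator : adapted FF compensator.
Proof.
move=> t t0; have sF := filtration_sigma filtration_passage t0.
apply: (@measurable_wrt_comp _ _ _ _
  (fun w => elapsed (S w) (fine (mine t%:E (Tb w)))) (cumulative_hazard c)).
  have -> : (fun w => elapsed (S w) (fine (mine t%:E (Tb w)))) =
      (fun w => fine (mine t%:E (Tb w)) - fine (mine t%:E (S w))).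
    by apply/funext => w; exact: elapsed_capped.
  by apply: measurable_wrtB => //; exact: (measurable_capped filtration_passage).
exact: (continuous_measurable_fun (continuous_cumulative_hazard c0)).
Qed.

Lemma continuous_compensator w : continuous (compensator^~ w).
Proof.
move=> t; apply: (@cvg_comp _ _ _ (fun t => fine (mine t%:E (Tb w)))
  (fun u => cumulative_hazard c (elapsed (S w) u))).
  exact: continuous_capped.
apply: (@cvg_comp _ _ _ (elapsed (S w)) (cumulative_hazard c)).
  exact: continuous_elapsed.
exact: continuous_cumulative_hazard.
Qed.

Lemma compensator_ge0 t w : 0 <= t -> 0 <= compensator t w.
Proof.
move=> t0; rewrite -RintegralE//; apply: Rintegral_ge0 => s _.
exact: hazard_until_ge0.
Qed.

Lemma measurable_intensity w : measurable_fun setT (intensity^~ w).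
Proof.
apply: measurable_fun_ifT => //.
  by apply: measurable_fun_lte => //; exact/measurable_EFinP.
apply: (measurableT_comp (continuous_measurable_fun (continuous_passage_hazard c0))).
by apply: continuous_measurable_fun; exact: continuous_elapsed.
Qed.

Lemma compensator_le w s t : 0 <= s -> s <= t -> compensator s w <= compensator t w.
Proof.
move=> s0 st; have t0 := le_trans s0 st.
suff : (\int[mu]_(r in `[0%R, s]) (intensity r w)%:E <=
        \int[mu]_(r in `[0%R, t]) (intensity r w)%:E)%E.
  have [es et] := (integral_intensity w s0, integral_intensity w t0).
  by rewrite es et lee_fin.
apply: ge0_subset_integral.
- exact: measurable_itv.
- exact: measurable_itv.
- by apply/measurable_EFinP; apply: measurable_funTS; exact: measurable_intensity.
- by move=> r _; rewrite lee_fin hazard_until_ge0.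
- by move=> r /=; rewrite !in_itv/= => /andP[-> /le_trans->].
Qed.

Lemma compensator0 w : compensator 0 w = 0.
Proof.
rewrite /compensator min_l// elapsed_before ?cumulative_hazard0//.
Qed.

Let passed t := [set w | Tb w <= t%:E]%E.

Let measurable_passed t : 0 <= t -> measurable (passed t).
Proof.
move=> t0; exact: (filtration_measurable G_filtration t0 ((stopping_first b).2 _ t0)).
Qed.

Let compensated t w : R := occurred Tb t w - compensator t w.

Lemma adapted_compensated : adapted FF compensated.
Proof.
move=> t t0; have sF := filtration_sigma filtration_passage t0.
apply: (measurable_wrtB sF); last exact: adapted_compensator.
by apply: (measurable_wrt_indic sF); exact: stopping_Tb_F.2.
Qed.

Lemma measurable_compensator t : 0 <= t -> measurable_fun setT (compensator t).
Proof.
by move=> t0; apply: (measurable_wrt_fun filtration_passage t0); exact: adapted_compensator.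
Qed.

Lemma integral_compensator A t : known A -> 0 <= t ->
  (\int[P]_(w in A) (compensator t w)%:E = P (A `&` passed t))%E.
Proof.
move=> kA t0; symmetry.
exact: (compensation P_complete G_filtration G_usual B_brownian M_ge0 M_le sup_lt kA t0).
Qed.

Lemma integrable_compensator t : 0 <= t -> P.-integrable setT (EFin \o compensator t).
Proof.
move=> t0; apply/integrableP; split.
  by apply/measurable_EFinP; exact: measurable_compensator.
rewrite (eq_integral (fun w => (compensator t w)%:E)); last first.
  by move=> w _ /=; rewrite ger0_norm// compensator_ge0.
rewrite integral_compensator//; last exact: sub_sigma_setT.
rewrite -ge0_fin_numE//; apply: fin_num_measure; apply: measurableI => //.
exact: measurable_passed.
Qed.

Lemma integrable_occurred t : 0 <= t -> P.-integrable setT (EFin \o occurred Tb t).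
Proof.
move=> t0; apply: integrable_indic => //; exact: measurable_passed.
Qed.

Lemma integrable_compensated t : 0 <= t -> P.-integrable setT (EFin \o compensated t).
Proof.
move=> t0; have -> : EFin \o compensated t = ((EFin \o occurred Tb t) \- (EFin \o compensator t))%E.
  by apply/funext => w; rewrite /= EFinB.
by apply: integrableB => //; [exact: integrable_occurred|exact: integrable_compensator].
Qed.

Lemma integral_compensated_known A t : known A -> 0 <= t ->
  (\int[P]_(w in A) (compensated t w)%:E = 0)%E.
Proof.
move=> kA t0; have mA := known_measurable kA.
have iN := integrableS measurableT mA (@subsetT _ A) (integrable_occurred t0).
have iC := integrableS measurableT mA (@subsetT _ A) (integrable_compensator t0).
transitivity (\int[P]_(w in A) ((occurred Tb t w)%:E - (compensator t w)%:E))%E.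
  by apply: eq_integral => w _; rewrite EFinB.
rewrite (integralB mA iN iC) integral_compensator// integral_indic//; last exact: measurable_passed.
rewrite setIC subee//; apply: fin_num_measure.
by apply: measurableI => //; exact: measurable_passed.
Qed.

Let compensated_after u t w : 0 <= u -> u <= t -> (Tb w <= u%:E)%E ->
  compensated t w = compensated u w.
Proof.
move=> u0 ut Tu; have Tt : (Tb w <= t%:E)%E by rewrite (le_trans Tu)// lee_fin.
by rewrite /compensated /occurred !indicE /compensator !min_r// !mem_set.
Qed.

(** After the passage at [b] the compensated process does not move; before it, the
    event [E] can be replaced by an event of the past of [S]. The strict
    inequality between [s] and [u] absorbs the right limit in the filtration. *)
Lemma integral_compensated_after s u t E : 0 <= s -> s < u -> u <= t -> FF s E ->
  (\int[P]_(w in E) (compensated t w)%:E = \int[P]_(w in E) (compensated u w)%:E)%E.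
Proof.
move=> s0 su ut FE; have u0 : 0 <= u by rewrite ltW// (le_lt_trans s0).
have t0 := le_trans u0 ut.
have mE := filtration_measurable filtration_passage s0 FE.
have [A kA EA] := trace_before_passage s0 su FE.
have mA := known_measurable kA.
pose V := [set w | u%:E < Tb w]%E.
pose D w := ((compensated t w)%:E - (compensated u w)%:E)%E.
have DV : D \_ V = D.
  apply/funext => w; rewrite patchE; case: ifPn => // nV.
  rewrite /D (@compensated_after u t)// ?subee//; rewrite leNgt; apply/negP => uT.
  by move: nV; rewrite mem_set.
have iD (Z : set T) : measurable Z -> (\int[P]_(w in Z) D w =
    \int[P]_(w in Z) (compensated t w)%:E - \int[P]_(w in Z) (compensated u w)%:E)%E.
  move=> mZ; apply: (integralB mZ).
  - exact: (integrableS measurableT mZ (@subsetT _ Z) (integrable_compensated t0)).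
  - exact: (integrableS measurableT mZ (@subsetT _ Z) (integrable_compensated u0)).
have DE : (\int[P]_(w in E) D w = 0)%E.
  have toV Z : (\int[P]_(w in Z) D w = \int[P]_(w in Z `&` V) D w)%E.
    by rewrite integral_mkcondr DV.
  apply: (etrans (toV E)).
  apply: (etrans (congr1 (fun Z => \int[P]_(w in Z) D w)%E EA)).
  apply: (etrans (esym (toV A))).
  apply: (etrans (iD A mA)).
  have [eA1 eA2] := (integral_compensated_known kA t0, integral_compensated_known kA u0).
  exact: (etrans (congr2 (fun x y => x - y)%E eA1 eA2) (sube0 0%E)).
have finX (r : R) : 0 <= r -> (\int[P]_(w in E) (compensated r w)%:E)%E \is a fin_num.
  move=> r0; apply: integrable_fin_num => //.
  exact: (integrableS measurableT mE (@subsetT _ E) (integrable_compensated r0)).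
have sub_eq (x y : \bar R) : x \is a fin_num -> y \is a fin_num -> (x - y = 0)%E -> x = y.
  by move: x y => [x||] [y||]// _ _ [/subr0_eq->].
exact: (sub_eq _ _ (finX t t0) (finX u u0) (etrans (esym (iD E mE)) DE)).
Qed.

Lemma measurable_compensated t : 0 <= t -> measurable_fun setT (compensated t).
Proof.
by move=> t0; apply: (measurable_wrt_fun filtration_passage t0); exact: adapted_compensated.
Qed.

(** Makes it possible to let [u] decrease to [s] in [integral_compensated_after]. *)
Lemma compensated_right_limit w s (u : nat -> R) : (forall n, s <= u n) ->
  u n @[n --> \oo] --> s -> compensated (u n) w @[n --> \oo] --> compensated s w.
Proof.
move=> su us; apply: cvgB; last first.
  by apply: (@cvg_comp _ _ _ u (compensator^~ w) _ _ _ us); exact: continuous_compensator.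
apply: cvg_near_cst; rewrite /occurred; have [Ts|sT] := leP (Tb w) s%:E.
  apply: nearW => n; rewrite !indicE !mem_set//=.
  by apply: le_trans Ts _; rewrite lee_fin.
have : \forall n \near \oo, ((u n)%:E < Tb w)%E.
  case E : (Tb w) sT => [r||]// sT; last by apply: nearW => n; exact: ltry.
  exact: (cvgr_lt s us).
apply: filterS => n unT; rewrite !indicE !memNset//=; apply/negP; rewrite -ltNge//.
Qed.

Lemma compensated_bound w u t : 0 <= u -> u <= t -> `|compensated u w| <= 1 + compensator t w.
Proof.
move=> u0 ut; have c1 := compensator_ge0 w u0; have c2 := compensator_le w u0 ut.
have N01 : 0 <= occurred Tb u w <= 1.
  by rewrite /occurred indicE; case: (_ \in _); rewrite ?lexx ?ler01.
exact: norm_sub_unit N01 c1 c2.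
Qed.

Lemma integral_compensated s t E : 0 <= s -> s <= t -> FF s E ->
  (\int[P]_(w in E) (compensated s w)%:E = \int[P]_(w in E) (compensated t w)%:E)%E.
Proof.
move=> s0; rewrite le_eqVlt => /predU1P[<-//|st] FE.
have t0 : 0 <= t by rewrite ltW// (le_lt_trans s0).
have mE := filtration_measurable filtration_passage s0 FE.
pose u n : R := s + (t - s) * n.+1%:R^-1.
have su n : s < u n by rewrite ltrDl mulr_gt0 ?subr_gt0 ?invr_gt0.
have ut n : u n <= t.
  by rewrite -lerBrDl ler_piMr ?subr_ge0 ?(ltW st)// invf_le1// ler1n.
have u0 n : 0 <= u n by rewrite (le_trans s0)// ltW.
have us : u n @[n --> \oo] --> s.
  rewrite -[X in _ --> X]addr0; apply: cvgD; first exact: cvg_cst.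
  rewrite -[X in _ --> X](mulr0 (t - s)); apply: cvgMr; exact: cvg_harmonic.
have const n : (\int[P]_(w in E) (compensated (u n) w)%:E =
    \int[P]_(w in E) (compensated t w)%:E)%E.
  by apply/esym; exact: (integral_compensated_after s0 (su n) (ut n) FE).
have mX r : 0 <= r -> measurable_fun E (EFin \o compensated r).
  by move=> r0; apply/measurable_EFinP; apply: measurable_funTS; exact: measurable_compensated.
have ptw : {ae P, forall w, E w ->
    (EFin \o compensated (u n)) w @[n --> \oo] --> (EFin \o compensated s) w}.
  apply: aeW => w _; apply: cvg_EFin; first exact: nearW.
  by apply: compensated_right_limit => // n; exact: ltW.
have dom : P.-integrable E (fun w => (1 + compensator t w)%:E).
  apply: (integrableS measurableT mE (@subsetT _ E)).
  have -> : (fun w => (1 + compensator t w)%:E) = (cst 1 \+ (EFin \o compensator t))%E.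
    by apply/funext => w; rewrite /= EFinD.
  apply: integrableD => //; last exact: integrable_compensator.
  exact: (finite_measure_integrable_cst P 1).
have bound : {ae P, forall w n, E w ->
    (`|(EFin \o compensated (u n)) w| <= (1 + compensator t w)%:E)%E}.
  by apply: aeW => w n _; rewrite lee_fin; exact: compensated_bound.
have [_ _ lim] := dominated_convergence mE (fun n => mX _ (u0 n)) (mX _ s0) ptw dom bound.
have cst_lim : (fun n => \int[P]_(w in E) (EFin \o compensated (u n)) w)%E =
    (fun n => \int[P]_(w in E) (compensated t w)%:E)%E.
  by apply/funext => n; exact: const.
have lim' : (fun n : nat => \int[P]_(w in E) (compensated t w)%:E)%E @ \oo -->
    (\int[P]_(w in E) (compensated s w)%:E)%E.
  by rewrite -cst_lim; exact: lim.
exact: (cvg_unique _ lim' (@cvg_cst _ _ _ _ _)).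
Qed.

Lemma martingale_compensated : martingale P FF compensated.
Proof.
split; first exact: adapted_compensated.
split=> [t t0|s t s0 st]; first exact: integrable_compensated.
split; [exact: adapted_compensated|split; first exact: integrable_compensated].
by move=> E FE; exact: integral_compensated.
Qed.

Let integrated_intensity t w : R := \int[mu]_(s in `[0, t]) intensity s w.

Let integrated_intensityE t w : 0 <= t -> integrated_intensity t w = compensator t w.
Proof. exact: RintegralE. Qed.

(** A continuous adapted process is predictable. *)
Lemma predictable_integrated_intensity : predictable FF integrated_intensity.
Proof.
move=> U mU; apply: sub_sigma_algebra; exists integrated_intensity, U; split => //.
- move=> t t0 V mV; have -> : integrated_intensity t = compensator t.
    by apply/funext => w; exact: integrated_intensityE.
  exact: adapted_compensator.
- move=> w t t0; rewrite integrated_intensityE ?ltW//.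
  apply: (@cvg_trans _ (compensator s w @[s --> t^'-])).
    apply: near_eq_cvg; near=> s; rewrite integrated_intensityE//.
    by near: s; apply: nbhs_left_ge.
  exact/cvg_at_left_filter/continuous_compensator.
Unshelve. all: by end_near. Qed.

Lemma is_compensator_integrated_intensity :
  is_compensator P FF (occurred Tb) integrated_intensity.
Proof.
split.
- exact: predictable_integrated_intensity.
- by move=> w; rewrite integrated_intensityE ?compensator0.
- by move=> w s t s0 st; rewrite !integrated_intensityE ?compensator_le// (le_trans s0).
- move=> w t t0; rewrite integrated_intensityE//.
  apply: (@cvg_trans _ (compensator s w @[s --> t^'+])).
    apply: near_eq_cvg; near=> s; rewrite integrated_intensityE//.
    by rewrite (le_trans t0)// ltW//; near: s; exact: nbhs_right_gt.
  exact/cvg_at_right_filter/continuous_compensator.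
- have [aX [iX cX]] := martingale_compensated.
  have E t : 0 <= t ->
      (fun w => occurred Tb t w - integrated_intensity t w) = compensated t.
    by move=> t0; apply/funext => w; rewrite integrated_intensityE.
  split=> [t t0|]; first by rewrite (E t t0); exact: aX.
  split=> [t t0|s t s0 st]; first by rewrite (E t t0); exact: iX.
  by rewrite (E s s0) (E t (le_trans s0 st)); exact: cX.
Unshelve. all: by end_near. Qed.

Lemma passage_compensator :
  absolutely_continuous_compensator P FF Tb.
Proof.
exists intensity; split.
- exact: adapted_intensity.
- apply: measurable_funTS.
  have mswap : measurable_fun setT (fun p : R * T => (p.2, p.1) : T * measurableTypeR R).
    by apply: measurable_fun_pair; [exact: measurable_snd|exact: measurable_fst].
  exact: (measurableT_comp (measurable_joint_hazard c0 measurable_S measurable_Tb) mswap).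
- move=> w t t0; apply/integrableP; split.
    by apply/measurable_EFinP; apply: measurable_funTS; exact: measurable_intensity.
  suff -> : (fun s => `|(intensity s w)%:E|%E) = (fun s => (intensity s w)%:E).
    by have := integral_intensity w t0 => ->; exact: ltry.
  by apply/funext => s; rewrite gee0_abs// lee_fin hazard_until_ge0.
- exact: is_compensator_integrated_intensity.
Qed.

End PassageFiltration.

Unset Implicit Arguments.

Theorem theorem5 (R : realType) (d : measure_display) (T : measurableType d)
  (P : probability T R) (G : R -> set (set T)) (B : R -> T -> R)
  (L : set R) (b : R)
  (P_complete : measure_is_complete P)
  (G_filtration : filtration G)
  (G_usual : usual_conditions P G)
  (B_brownian : brownian_motion P G B)
  (L_nonneg : forall x, L x -> 0 <= x)
  (b_left_isolated : left_isolated L b) :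
  absolutely_continuous_compensator P (passage_filtration P B L)
    (first_passage B b).
Proof.
case: b_left_isolated => Lb sup_lt.
exact: (passage_compensator P_complete G_filtration G_usual B_brownian
  L_nonneg Lb sup_lt).
Qed.
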